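(* Let $\Gamma,\Lambda$ be two countable groups, where $\Lambda$ is infinite and amenable. Then $\operatorname{H}_a^n(\Gamma\wr\Lambda,\mathcal{V})=0$ for all $n\ge 1$ and all finitary dual asymptotic Banach ${}^{*}(\Gamma\wr\Lambda)$-modules $\mathcal{V}$.
   Context: The *lamplighter* (restricted wreath product) is $\Gamma\wr\Lambda=(\bigoplus_\Lambda\Gamma)\rtimes\Lambda$, where $\Lambda$ acts by shifting the coordinates. All groups are discrete and countable. **Asymptotic modules.** Fix a non-principal ultrafilter $\omega$ on $\mathbb{N}$. For sets $X_n$, $\prod_\omega X_n$ is the algebraic ultraproduct (sequences modulo equality on a set in $\omega$). ${}^{*}G=\prod_\omega G$ for a group $G$, ${}^{*}\mathbb{R}=\prod_\omega\mathbb{R}$, ${}^{*}\mathbb{R}_b$ is the set of bounded hyperreals and ${}^{*}\mathbb{R}_{inf}$ the set of infinitesimals. A map between ultraproducts is *internal* if it is induced by a sequence of maps. For Banach spaces $V_n$ let $\mathcal{V}=\prod_\omega V_n$ with ${}^{*}\mathbb{R}$-valued norm $\|\{v_n\}_\omega\|=\{\|v_n\|\}_\omega$, $\mathcal{V}_b=\{v:\|v\|\in{}^{*}\mathbb{R}_b\}$, $\mathcal{V}_{inf}=\{v:\|v\|\in{}^{*}\mathbb{R}_{inf}\}$ and $\widetilde{\mathcal{V}}=\mathcal{V}_b/\mathcal{V}_{inf}$, a real Banach space. An *asymptotic Banach ${}^{*}G$-module* is such a $\mathcal{V}$ together with an internal map $\pi=\{\pi_n\}_\omega:{}^{*}G\times\mathcal{V}\to\mathcal{V}$,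 where each $\pi_n(g):V_n\to V_n$ is linear and norm-preserving, which induces an isometric linear action $\tilde\pi$ of ${}^{*}G$ on $\widetilde{\mathcal{V}}$. The internal dual is $\mathcal{V}^\#=\prod_\omega V_n^\#$ ($V_n^\#$ the continuous dual), with the contragredient $\pi^\#$ defined coordinatewise by $(\pi_n^\#(g)\lambda)(v)=\lambda(\pi_n(g^{-1})v)$. $\mathcal{V}$ is a *dual* asymptotic Banach ${}^{*}G$-module if it is the internal dual, with contragredient action, of some asymptotic Banach ${}^{*}G$-module $\mathcal{V}^\flat$. It is *finitary* if each $V_n$ is finite-dimensional. **Asymptotic cohomology.** For $m\ge1$ let $\mathcal{L}^\infty(({}^{*}G)^m,\mathcal{V})=\prod_\omega\ell^\infty(G^m,V_n)$, with bounded and infinitesimal parts (for the sup norms) $\mathcal{L}^\infty_b$, $\mathcal{L}^\infty_{inf}$ and quotient $\widetilde{\mathcal{L}}^\infty(({}^{*}G)^m,\mathcal{V})=\mathcal{L}^\infty_b/\mathcal{L}^\infty_{inf}$. ${}^{*}G$ acts on this quotient via $(g\cdot f)(g_1,\dots,g_m)=\pi(g)f(g^{-1}g_1,\dots,g^{-1}g_m)$; invariants are denoted by the superscript ${}^{*}G$. Define $d^m:\mathcal{L}^\infty(({}^{*}G)^m,\mathcal{V})\to\mathcal{L}^\infty(({}^{*}G)^{m+1},\mathcal{V})$ by $d^m f(g_0,\dots,g_m)=\sum_{j=0}^m(-1)^jf(g_0,\dots,\widehat{g_j},\dots,g_m)$. It induces maps $\tilde d^m$ giving the complex $0\xrightarrow{\tilde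 d^0}\widetilde{\mathcal{L}}^\infty({}^{*}G,\mathcal{V})^{{}^{*}G}\xrightarrow{\tilde d^1}\widetilde{\mathcal{L}}^\infty(({}^{*}G)^2,\mathcal{V})^{{}^{*}G}\xrightarrow{\tilde d^2}\cdots$, and $\operatorname{H}_a^m(G,\mathcal{V})=\ker(\tilde d^{m+1})/\operatorname{im}(\tilde d^m)$ for $m\ge0$. *)

(* Defs.v *)
From HB Require Import structures.
From mathcomp Require Import all_boot all_order all_algebra.
From mathcomp Require Import finmap.
From mathcomp Require Import generic_quotient ring_quotient.
From mathcomp Require Import all_classical all_reals topology normedtype.

Set Implicit Arguments.
Unset Strict Implicit.
Unset Printing Implicit Defensive.

Import Order.TTheory GRing.Theory Num.Theory.
Import numFieldNormedType.Exports.

Local Open Scope classical_set_scope.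
Local Open Scope ring_scope.
Local Open Scope quotient_scope.

Record nonprincipal_ultrafilter := NonprincipalUltrafilter {
  ultra_sets :> set nat -> Prop ;
  ultra_ultra : UltraFilter ultra_sets ;
  ultra_nonprincipal : forall n : nat, ultra_sets <> principal_filter n
}.

#[global] Instance ultra_sets_ultra (w : nonprincipal_ultrafilter) :
  UltraFilter (ultra_sets w) := ultra_ultra w.

Section Ultraproduct.
Variable w : nonprincipal_ultrafilter.

Section Def.
Variable X : nat -> Type.

Definition ueq : rel {classic (forall n, X n)} := fun x y =>
  `[< w [set n | x n = y n] >].

Lemma ueq_equiv : equiv_class_of ueq.
Proof.
split=> [x|x y|y x z].
- by apply/asboolP; exact: filterE.
- by apply/asboolP/asboolP; apply: filterS => n /= ->.
- move=> /asboolP xy /asboolP yz; apply/asboolP.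
  by apply: filterS2 xy yz => n /= -> ->.
Qed.

Canonical ueq_equiv_rel := EquivRelPack ueq_equiv.
Canonical ueq_encModRel := defaultEncModRel ueq.

Definition uprod := {eq_quot ueq}.
HB.instance Definition _ := Choice.on uprod.
HB.instance Definition _ : EqQuotient _ ueq uprod := EqQuotient.on uprod.

Definition uclass (x : forall n, X n) : uprod :=
  \pi_uprod (x : {classic (forall n, X n)}).

Definition urepr (x : uprod) : forall n, X n := repr x.

Lemma uclassP (x y : forall n, X n) :
  uclass x = uclass y <-> w [set n | x n = y n].
Proof.
split=> [/eqmodP /asboolP//|h].
by apply/eqmodP/asboolP.
Qed.

Lemma uclass_repr (x : uprod) : uclass (urepr x) = x.
Proof. exact: reprK. Qed.

Lemma repr_uclass (x : forall n, X n) :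
  w [set n | urepr (uclass x) n = x n].
Proof. by apply/uclassP; rewrite uclass_repr. Qed.

End Def.

Definition umap (X Y : nat -> Type) (F : forall n, X n -> Y n)
  (x : uprod X) : uprod Y := uclass (fun n => F n (urepr x n)).

Definition umap2 (X Y Z : nat -> Type) (F : forall n, X n -> Y n -> Z n)
  (x : uprod X) (y : uprod Y) : uprod Z :=
  uclass (fun n => F n (urepr x n) (urepr y n)).

Lemma umapE (X Y : nat -> Type) (F : forall n, X n -> Y n)
    (x : forall n, X n) :
  umap F (uclass x) = uclass (fun n => F n (x n)).
Proof. by apply/uclassP; apply: filterS (repr_uclass x) => n /= ->. Qed.

Lemma umap2E (X Y Z : nat -> Type) (F : forall n, X n -> Y n -> Z n)
    (x : forall n, X n) (y : forall n, Y n) :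
  umap2 F (uclass x) (uclass y) = uclass (fun n => F n (x n) (y n)).
Proof.
by apply/uclassP; apply: filterS2 (repr_uclass x) (repr_uclass y) => n /= -> ->.
Qed.

End Ultraproduct.

Section StarGroup.
Variables (w : nonprincipal_ultrafilter) (G : groupType).

Definition star_group := uprod w (fun=> G).

HB.instance Definition _ := Choice.on star_group.

Definition star_one : star_group := @uclass w (fun=> G) (fun=> 1%g).
Definition star_mul : star_group -> star_group -> star_group :=
  umap2 (fun n (a b : G) => (a * b)%g).
Definition star_inv : star_group -> star_group :=
  umap (fun n (a : G) => a^-1%g).

Lemma star_mulA : associative star_mul.
Proof.
move=> x y z; rewrite -(uclass_repr x) -(uclass_repr y) -(uclass_repr z).
by rewrite /star_mul !umap2E; congr uclass; apply/funext => n; rewrite mulgA.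
Qed.

Lemma star_mul1g : left_id star_one star_mul.
Proof.
move=> x; rewrite -(uclass_repr x) /star_mul !umap2E.
by congr uclass; apply/funext => n; rewrite mul1g.
Qed.

Lemma star_mulg1 : right_id star_one star_mul.
Proof.
move=> x; rewrite -(uclass_repr x) /star_mul !umap2E.
by congr uclass; apply/funext => n; rewrite mulg1.
Qed.

Lemma star_mulVg : left_inverse star_one star_inv star_mul.
Proof.
move=> x; rewrite -(uclass_repr x) /star_mul /star_inv umapE !umap2E.
by congr uclass; apply/funext => n; rewrite mulVg.
Qed.

Lemma star_mulgV : right_inverse star_one star_inv star_mul.
Proof.
move=> x; rewrite -(uclass_repr x) /star_mul /star_inv umapE !umap2E.
by congr uclass; apply/funext => n; rewrite mulgV.
Qed.

HB.instance Definition _ := isGroup.Build star_group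
  star_mulA star_mul1g star_mulg1 star_mulVg star_mulgV.

End StarGroup.

(* Boundedness and infinitesimality are read on an arbitrary representative,
   which is harmless since they only depend on it up to a set in w;
   [uspace_boundedP] and [uspace_infinitesimalP] spell this out. *)
Section Hyperreal.
Variables (w : nonprincipal_ultrafilter) (R : realType).

Definition hyperreal := uprod w (fun=> R).

Definition hyper_bounded (x : hyperreal) :=
  exists M : R, w [set n | `|urepr x n| <= M].

Definition hyper_infinitesimal (x : hyperreal) :=
  forall e : R, 0 < e -> w [set n | `|urepr x n| <= e].

End Hyperreal.

Section AsymptoticSpace.
Variables (w : nonprincipal_ultrafilter) (R : realType).
Variable V : nat -> normedModType R.

(* Only the additive group structures of the ultraproduct and of its
   subquotient [tilde] are recorded: the scalars play no role in the
   definition of the cohomology groups. *)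
Definition uspace := uprod w (fun n => V n).

HB.instance Definition _ := Choice.on uspace.

Definition uspace_zero : uspace := @uclass w (fun n => V n) (fun=> 0).
Definition uspace_opp : uspace -> uspace := umap (fun n (x : V n) => - x).
Definition uspace_add : uspace -> uspace -> uspace :=
  umap2 (fun n (x y : V n) => x + y).

Lemma uspace_addA : associative uspace_add.
Proof.
move=> x y z; rewrite -(uclass_repr x) -(uclass_repr y) -(uclass_repr z).
rewrite /uspace_add !umap2E; congr uclass.
by apply/functional_extensionality_dep => n; rewrite addrA.
Qed.

Lemma uspace_addC : commutative uspace_add.
Proof.
move=> x y; rewrite -(uclass_repr x) -(uclass_repr y).
rewrite /uspace_add !umap2E; congr uclass.
by apply/functional_extensionality_dep => n; rewrite addrC.
Qed.

Lemma uspace_add0 : left_id uspace_zero uspace_add.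
Proof.
move=> x; rewrite -(uclass_repr x) /uspace_add !umap2E.
by congr uclass; apply/functional_extensionality_dep => n; rewrite add0r.
Qed.

Lemma uspace_addN : left_inverse uspace_zero uspace_opp uspace_add.
Proof.
move=> x; rewrite -(uclass_repr x) /uspace_add /uspace_opp umapE !umap2E.
by congr uclass; apply/functional_extensionality_dep => n; rewrite addNr.
Qed.

HB.instance Definition _ := GRing.isZmodule.Build uspace
  uspace_addA uspace_addC uspace_add0 uspace_addN.

Definition unorm : uspace -> hyperreal w R := umap (fun n (x : V n) => `|x|).

Definition uspace_bounded : {pred uspace} :=
  fun v => `[< hyper_bounded (unorm v) >].

Definition uspace_infinitesimal : {pred uspace} :=
  fun v => `[< hyper_infinitesimal (unorm v) >].

Lemma uspace_boundedP (v : forall n, V n) :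
  (uclass w v : uspace) \in uspace_bounded <->
  exists M : R, w [set n | `|v n| <= M].
Proof.
rewrite /in_mem /= /uspace_bounded /hyper_bounded /unorm umapE.
have h := repr_uclass w (fun n => `|v n|).
split=> [/asboolP[M HM]|[M HM]].
  by exists M; apply: filterS2 h HM => n /= ->; rewrite normr_id.
by apply/asboolP; exists M; apply: filterS2 h HM => n /= ->; rewrite normr_id.
Qed.

Lemma uspace_infinitesimalP (v : forall n, V n) :
  (uclass w v : uspace) \in uspace_infinitesimal <->
  forall e : R, 0 < e -> w [set n | `|v n| <= e].
Proof.
rewrite /in_mem /= /uspace_infinitesimal /hyper_infinitesimal /unorm umapE.
have h := repr_uclass w (fun n => `|v n|).
split=> [/asboolP H e e0|H].
  by apply: filterS2 h (H e e0) => n /= ->; rewrite normr_id.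
by apply/asboolP => e e0; apply: filterS2 h (H e e0) => n /= ->; rewrite normr_id.
Qed.

Lemma uspace_subE (u v : forall n, V n) :
  (uclass w u : uspace) - (uclass w v : uspace) = uclass w (fun n => u n - v n).
Proof. by rewrite /GRing.add /GRing.opp /= /uspace_add /uspace_opp umapE umap2E. Qed.

Lemma uspace_bounded_closed : zmod_closed uspace_bounded.
Proof.
split=> [|x y].
  apply/uspace_boundedP; exists 0; apply: filterE => n /=.
  by rewrite normr0.
rewrite -(uclass_repr x) -(uclass_repr y).
move=> /uspace_boundedP[M HM] /uspace_boundedP[N HN].
rewrite uspace_subE; apply/uspace_boundedP; exists (M + N).
apply: filterS2 HM HN => n /= h1 h2.
by rewrite (le_trans (ler_normB _ _))// lerD.
Qed.

HB.instance Definition _ := GRing.isZmodClosed.Build uspace uspace_bounded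
  uspace_bounded_closed.

Record bspace := BSpace {
  bspace_val :> uspace ; bspace_valP : bspace_val \in uspace_bounded }.

HB.instance Definition _ := [isSub for bspace_val].
HB.instance Definition _ := [Choice of bspace by <:].
HB.instance Definition _ := [SubChoice_isSubZmodule of bspace by <:].

Definition bspace_infinitesimal : {pred bspace} :=
  fun v => val v \in uspace_infinitesimal.

Lemma bspace_infinitesimal_closed : zmod_closed bspace_infinitesimal.
Proof.
split=> [|x y]; rewrite /in_mem /= /bspace_infinitesimal.
  apply/uspace_infinitesimalP => e e0; apply: filterE => n /=.
  by rewrite normr0 ltW.
rewrite raddfB /= -(uclass_repr (bspace_val x)) -(uclass_repr (bspace_val y)).
move=> /uspace_infinitesimalP H /uspace_infinitesimalP K.
rewrite uspace_subE; apply/uspace_infinitesimalP => e e0.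
have e2 : 0 < e / 2 by rewrite divr_gt0.
apply: filterS2 (H _ e2) (K _ e2) => n /= h1 h2.
by rewrite (le_trans (ler_normB _ _))// (splitr e) lerD.
Qed.

HB.instance Definition _ := GRing.isZmodClosed.Build bspace bspace_infinitesimal
  bspace_infinitesimal_closed.

(* The quotient of the bounded elements by the infinitesimal ones. *)
Definition tilde := Quotient.quot bspace_infinitesimal.
HB.instance Definition _ := GRing.Zmodule.on tilde.

End AsymptoticSpace.

Section InternalMaps.
Variables (w : nonprincipal_ultrafilter) (R : realType).

(* The class of a bounded element; on unbounded ones the value 0 is junk. *)
Definition tclass (V : nat -> normedModType R) (v : uspace w V) : tilde w V :=
  \pi_(tilde w V) (insubd (0 : bspace w V) v).

Definition trepr (V : nat -> normedModType R) (x : tilde w V) : uspace w V :=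
  val (repr x).

Lemma trepr_bounded (V : nat -> normedModType R) (x : tilde w V) :
  trepr x \in @uspace_bounded w R V.
Proof. exact: (valP (repr x)). Qed.

Lemma tclass_repr (V : nat -> normedModType R) (x : tilde w V) :
  tclass (trepr x) = x.
Proof. by rewrite /tclass /trepr valKd; exact: reprK. Qed.

Lemma tclass_eqP (V : nat -> normedModType R) (u v : uspace w V) :
  u \in @uspace_bounded w R V -> v \in @uspace_bounded w R V ->
  tclass u = tclass v <-> u - v \in @uspace_infinitesimal w R V.
Proof.
move=> hu hv.
have e : (insubd (0 : bspace w V) u - insubd (0 : bspace w V) v
            \in @bspace_infinitesimal w R V)
         = (u - v \in @uspace_infinitesimal w R V).
  by rewrite [LHS]/in_mem /= /bspace_infinitesimal raddfB /= !insubdK.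
rewrite -e Quotient.idealrBE; split; first by move=> h; apply/eqP.
by move/eqP.
Qed.

Lemma tclassB (V : nat -> normedModType R) (u v : uspace w V) :
  u \in @uspace_bounded w R V -> v \in @uspace_bounded w R V ->
  tclass (u - v) = tclass u - tclass v.
Proof.
move=> hu hv; rewrite /tclass -[RHS]raddfB; congr (\pi_(tilde w V) _).
by apply: val_inj; rewrite raddfB /= !insubdK// rpredB.
Qed.

Lemma tclass0 (V : nat -> normedModType R) : tclass (0 : uspace w V) = 0.
Proof. by rewrite -[in LHS](subrr 0) tclassB ?rpred0// subrr. Qed.

Definition uspace_map (V W : nat -> normedModType R) (F : forall n, V n -> W n) :
  uspace w V -> uspace w W := umap F.

(* The map induced by an internal map.  It is computed on a chosen
   representative; [tmapE] gives independence of the choice for internal maps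
   that are additive and uniformly bounded. *)
Definition tmap (V W : nat -> normedModType R) (F : forall n, V n -> W n)
  (x : tilde w V) : tilde w W := tclass (uspace_map F (trepr x)).

Definition bounded_internal (V W : nat -> normedModType R)
    (F : forall n, V n -> W n) :=
  (forall n, zmod_morphism (F n)) /\
  exists C : R, forall n v, `|F n v| <= C * `|v|.

Section TmapTheory.
Variables (V W : nat -> normedModType R) (F : forall n, V n -> W n).
Hypothesis bF : bounded_internal F.

Lemma umap_bounded (u : uspace w V) : u \in @uspace_bounded w R V ->
  uspace_map F u \in @uspace_bounded w R W.
Proof.
rewrite -(uclass_repr u) => /uspace_boundedP[M HM].
rewrite /uspace_map umapE; apply/uspace_boundedP.
case: bF => _ [C HC]; exists (`|C| * M); apply: filterS HM => n /= h.
rewrite (le_trans (HC _ _))// (le_trans (ler_norm _))//.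
by rewrite normrM normr_id ler_wpM2l.
Qed.

Lemma umapB (u v : uspace w V) :
  uspace_map F (u - v) = uspace_map F u - uspace_map F v.
Proof.
rewrite -(uclass_repr u) -(uclass_repr v) uspace_subE /uspace_map !umapE uspace_subE.
congr uclass; apply/functional_extensionality_dep => n.
by case: bF => aF _; rewrite aF.
Qed.

Lemma umap_infinitesimal (u : uspace w V) :
  u \in @uspace_infinitesimal w R V ->
  uspace_map F u \in @uspace_infinitesimal w R W.
Proof.
rewrite -(uclass_repr u) => /uspace_infinitesimalP H.
rewrite /uspace_map umapE; apply/uspace_infinitesimalP => e e0.
case: bF => _ [C HC].
have C0 : 0 < `|C| + 1 by rewrite ltr_wpDl.
apply: filterS (H (e / (`|C| + 1)) (divr_gt0 e0 C0)) => n /= h.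
rewrite (le_trans (HC _ _))// (@le_trans _ _ ((`|C| + 1) * `|urepr u n|))//.
  by rewrite ler_wpM2r// ler_wpDr// ler_norm.
by rewrite mulrC -ler_pdivlMr.
Qed.

Lemma tmapE (u : uspace w V) : u \in @uspace_bounded w R V ->
  tmap F (tclass u) = tclass (uspace_map F u).
Proof.
move=> hu; apply/tclass_eqP; try exact/umap_bounded/trepr_bounded.
  exact: umap_bounded.
rewrite -umapB; apply: umap_infinitesimal.
by apply/tclass_eqP => //; rewrite ?trepr_bounded ?tclass_repr.
Qed.

Lemma tmap_is_zmod_morphism : zmod_morphism (@tmap V W F).
Proof.
move=> x y; rewrite -(tclass_repr x) -(tclass_repr y).
rewrite -tclassB ?trepr_bounded// !tmapE ?rpredB ?trepr_bounded//.
by rewrite umapB tclassB// umap_bounded// trepr_bounded.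
Qed.

End TmapTheory.

End InternalMaps.

Section BoundedFunctions.
Variables (R : realType) (X : Type) (V : normedModType R).

(* The Banach space of bounded functions from X to V, with the sup norm. *)
Definition linf_pred : {pred X -> V} := fun f => `[< bounded_fun f >].

Lemma linf_predP (f : X -> V) :
  f \in linf_pred <-> exists M : R, forall x, `|f x| <= M.
Proof.
split.
  by move=> /asboolP/pinfty_ex_gt0[M _ h]; exists M => x; apply: h.
move=> [M h]; apply/asboolP; exists M; split; first exact: num_real.
by move=> y My x _ /=; rewrite (le_trans (h x))// ltW.
Qed.

Lemma linf_pred_closed : submod_closed linf_pred.
Proof.
split=> [|a f g].
  by apply/linf_predP; exists 0 => x; rewrite normr0.
move=> /linf_predP[M hM] /linf_predP[N hN]; apply/linf_predP.
exists (`|a| * M + N) => x.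
by rewrite (le_trans (ler_normD _ _))// lerD// normrZ ler_wpM2l.
Qed.

HB.instance Definition _ := GRing.isSubmodClosed.Build R (X -> V) linf_pred
  linf_pred_closed.

Record linf := Linf { linf_fun :> X -> V ; linfP : linf_fun \in linf_pred }.

HB.instance Definition _ := [isSub for linf_fun].
HB.instance Definition _ := [Choice of linf by <:].
HB.instance Definition _ := [SubChoice_isSubLmodule of linf by <:].

Definition linf_norm (f : linf) : R := sup (range (fun x => `|f x|)).

Lemma linf_normP (f : linf) (x : X) : `|f x| <= linf_norm f.
Proof.
have /linf_predP[M hM] := linfP f.
apply: ub_le_sup; last by exists x.
by exists M => _ [y _ <-].
Qed.

Lemma linf_norm_le (f : linf) (M : R) : 0 <= M ->
  (forall x, `|f x| <= M) -> linf_norm f <= M.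
Proof.
move=> M0 h; rewrite /linf_norm.
have [->|/set0P ne] := eqVneq (range (fun x => `|f x|)) set0.
  by rewrite sup0.
by apply: ge_sup => // _ [y _ <-].
Qed.

Lemma linf_norm_ge0 (f : linf) : 0 <= linf_norm f.
Proof.
rewrite /linf_norm.
have [->|/set0P[_ [x _ _]]] := eqVneq (range (fun x => `|f x|)) set0.
  by rewrite sup0.
by rewrite (le_trans _ (linf_normP f x)).
Qed.

Lemma linf_normD (f g : linf) : linf_norm (f + g) <= linf_norm f + linf_norm g.
Proof.
apply: linf_norm_le => [|x]; first by rewrite addr_ge0 ?linf_norm_ge0.
by rewrite (le_trans (ler_normD _ _))// lerD// linf_normP.
Qed.

Lemma linf_normZ_le (a : R) (f : linf) :
  linf_norm (a *: f) <= `|a| * linf_norm f.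
Proof.
apply: linf_norm_le => [|x]; first by rewrite mulr_ge0 ?linf_norm_ge0.
by rewrite normrZ ler_wpM2l// linf_normP.
Qed.

Lemma linf_normZ (a : R) (f : linf) : linf_norm (a *: f) = `|a| * linf_norm f.
Proof.
apply/eqP; rewrite eq_le linf_normZ_le /=.
have [->|a0] := eqVneq a 0.
  by rewrite normr0 mul0r linf_norm_ge0.
rewrite -ler_pdivlMl ?normr_gt0// -normfV.
by have := linf_normZ_le a^-1 (a *: f); rewrite scalerA mulVf// scale1r.
Qed.

Lemma linf_norm0_eq0 (f : linf) : linf_norm f = 0 -> f = 0.
Proof.
move=> f0; apply: val_inj; apply/funext => x; apply/eqP.
by rewrite -normr_le0 -f0 linf_normP.
Qed.

HB.instance Definition _ := Lmodule_isNormed.Build R linf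
  linf_normD linf_normZ linf_norm0_eq0.

End BoundedFunctions.

Section ContinuousDual.
Variables (R : realType) (V : normedModType R).

(* The continuous dual, with the operator norm. *)
Definition cdual_pred : {pred V -> R^o} :=
  fun f => `[< linear f /\ continuous f >].

Lemma cdual_pred_closed : submod_closed cdual_pred.
Proof.
split=> [|a f g].
  apply/asboolP; split=> [b x y|x]; last exact: cst_continuous.
  by rewrite /= scaler0 addr0.
move=> /asboolP[lf cf] /asboolP[lg cg]; apply/asboolP; split.
  move=> b x y.
  rewrite -[LHS]/(a *: f (b *: x + y) + g (b *: x + y)).
  rewrite -[RHS]/(b *: (a *: f x + g x) + (a *: f y + g y)).
  rewrite lf lg !scalerDr !scalerA [b * a]mulrC !addrA; congr (_ + _).
  by rewrite -!addrA; congr (_ + _); rewrite addrC.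
move=> x; apply: cvgD; last exact: cg.
by apply: cvgZr; exact: cf.
Qed.

HB.instance Definition _ := GRing.isSubmodClosed.Build R (V -> R^o) cdual_pred
  cdual_pred_closed.

Record cdual := CDual { cdual_fun :> V -> R^o ;
                        cdualP : cdual_fun \in cdual_pred }.

HB.instance Definition _ := [isSub for cdual_fun].
HB.instance Definition _ := [Choice of cdual by <:].
HB.instance Definition _ := [SubChoice_isSubLmodule of cdual by <:].

Definition cdual_norm (f : cdual) : R :=
  sup [set `|f v| | v in [set v : V | `|v| <= 1]].

Lemma cdual_linear (f : cdual) : linear f.
Proof. by have /asboolP[] := cdualP f. Qed.

Lemma cdual_continuous (f : cdual) : continuous f.
Proof. by have /asboolP[] := cdualP f. Qed.

Lemma cdual0 (f : cdual) : f 0 = 0.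
Proof.
by have := cdual_linear f (-1) 0 0; rewrite scaler0 addr0 scaleN1r addNr.
Qed.

Lemma cdual_bounded (f : cdual) :
  exists2 M : R, 0 < M & forall v, `|f v| <= M * `|v|.
Proof.
pose g : {linear V -> R^o} := HB.pack (cdual_fun f)
  (GRing.isLinear.Build _ _ _ _ (cdual_fun f) (cdual_linear f)).
have : continuous g by exact: cdual_continuous.
move=> /linear_bounded_continuous/linear_boundedP/pinfty_ex_gt0[M M0 h].
by exists M.
Qed.

Lemma cdual_normP (f : cdual) (v : V) : `|v| <= 1 -> `|f v| <= cdual_norm f.
Proof.
move=> v1; apply: ub_le_sup; last by exists v.
have [M M0 h] := cdual_bounded f.
exists M => _ [u /= u1 <-]; rewrite (le_trans (h u))//.
by rewrite -[leRHS]mulr1 ler_wpM2l// ltW.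
Qed.

Lemma cdual_norm_le (f : cdual) (M : R) :
  (forall v : V, `|v| <= 1 -> `|f v| <= M) -> cdual_norm f <= M.
Proof.
move=> h; apply: ge_sup => [|_ [v v1 <-]]; last exact: h.
by exists `|f 0|, 0 => //=; rewrite normr0.
Qed.

Lemma cdual_norm_ge0 (f : cdual) : 0 <= cdual_norm f.
Proof. by rewrite (le_trans _ (@cdual_normP f 0 _)) ?normr0. Qed.

Lemma cdual_normD (f g : cdual) :
  cdual_norm (f + g) <= cdual_norm f + cdual_norm g.
Proof.
apply: cdual_norm_le => v v1.
by rewrite (le_trans (ler_normD _ _))// lerD// cdual_normP.
Qed.

Lemma cdual_normZ_le (a : R) (f : cdual) :
  cdual_norm (a *: f) <= `|a| * cdual_norm f.
Proof.
apply: cdual_norm_le => v v1.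
by rewrite normrZ ler_wpM2l// cdual_normP.
Qed.

Lemma cdual_normZ (a : R) (f : cdual) :
  cdual_norm (a *: f) = `|a| * cdual_norm f.
Proof.
apply/eqP; rewrite eq_le cdual_normZ_le /=.
have [->|a0] := eqVneq a 0.
  by rewrite normr0 mul0r cdual_norm_ge0.
rewrite -ler_pdivlMl ?normr_gt0// -normfV.
by have := cdual_normZ_le a^-1 (a *: f); rewrite scalerA mulVf// scale1r.
Qed.

Lemma cdual_norm0_eq0 (f : cdual) : cdual_norm f = 0 -> f = 0.
Proof.
move=> f0; apply: val_inj; apply/funext => v; apply/eqP.
have [->|v0] := eqVneq v 0.
  by apply/eqP; exact: (cdual0 f).
have nv : `|v| != 0 by rewrite normr_eq0.
have := @cdual_normP f (`|v|^-1 *: v); rewrite f0 normfZV// => /(_ (lexx _)).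
rewrite normr_le0 -[_ *: v]addr0.
rewrite (cdual_linear f `|v|^-1 v 0) cdual0.
by rewrite addr0 scaler_eq0 invr_eq0 (negPf nv).
Qed.

HB.instance Definition _ := Lmodule_isNormed.Build R cdual
  cdual_normD cdual_normZ cdual_norm0_eq0.

End ContinuousDual.

Section InducedAction.
Variables (w : nonprincipal_ultrafilter) (R : realType) (G : groupType).
Variables (V : nat -> normedModType R) (a : forall n, G -> V n -> V n).

(* The internal map star_group x uspace -> uspace induced by the sequence a,
   and the map it induces on [tilde w V]; see [tactE] for independence of
   representatives. *)
Definition uact (g : star_group w G) (v : uspace w V) : uspace w V :=
  umap2 a g v.

Definition tact (g : star_group w G) (x : tilde w V) : tilde w V :=
  tclass (uact g (trepr x)).

Lemma tactE (g : star_group w G) :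
    (forall n h, zmod_morphism (@a n h)) ->
    (forall n h v, `|@a n h v| = `|v|) ->
  forall u : uspace w V, u \in @uspace_bounded w R V ->
  tact g (tclass u) = tclass (uact g u).
Proof.
move=> alin anorm u hu.
have bF : bounded_internal (fun n => @a n (urepr g n)).
  by split=> [n|]; [exact: alin|exists 1 => n v; rewrite anorm mul1r].
exact: (tmapE bF hu).
Qed.

End InducedAction.

Section AsymptoticModules.
Variables (w : nonprincipal_ultrafilter) (R : realType) (G : groupType).

(* The individual maps [aact n] are not assumed to be actions: only the induced
   map on [tilde] is.  Linearity and norm preservation pass to it. *)
Record asymptotic_module := AsymptoticModule {
  amod :> nat -> completeNormedModType R ;
  aact : forall n, G -> amod n -> amod n ;
  aact_linear : forall n g, linear (@aact n g) ;
  aact_norm : forall n g v, `|@aact n g v| = `|v| ;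
  aact1 : forall x : tilde w amod, tact aact 1%g x = x ;
  aactM : forall (g h : star_group w G) (x : tilde w amod),
    tact aact (g * h)%g x = tact aact g (tact aact h x) }.

Definition finitary (V : asymptotic_module) :=
  forall n, exists k : nat, inhabited (Vector.axiom k (V n)).

Section Contragredient.
Variables (V : asymptotic_module) (n : nat) (g : G).

Lemma contragredient_subproof (f : cdual (V n)) :
  ((fun v => f (@aact V n g^-1%g v)) : V n -> R^o) \in @cdual_pred R (V n).
Proof.
have lin := @aact_linear V n g^-1%g.
have [lf cf] := (cdual_linear f, @cdual_continuous _ _ f).
apply/asboolP; split=> [b x y|]; first by rewrite lin lf.
pose p : {linear V n -> V n} := HB.pack (@aact V n g^-1%g)
  (GRing.isLinear.Build _ _ _ _ _ lin).
have cp : continuous p.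
  apply/linear_bounded_continuous/linear_boundedP.
  exists 1; split=> [|r /ltW r1 x]; first exact: num_real.
  by rewrite /= aact_norm ler_peMl.
by move=> x; apply: (@cvg_comp _ _ _ p f); [exact: cp|exact: cf].
Qed.

Definition contragredient (f : cdual (V n)) : cdual (V n) :=
  CDual (contragredient_subproof f).

End Contragredient.

(* V is the internal dual, with contragredient action, of an asymptotic module
   W, where identifications are along an internal isometric isomorphism. *)
Definition is_dual (V : asymptotic_module) :=
  exists (W : asymptotic_module) (phi : forall n, V n -> cdual (W n)),
  [/\ forall n, linear (phi n),
      forall n v, `|phi n v| = `|v|,
      forall n, bijective (phi n) &
      forall (g : star_group w G) (v : uspace w (fun n => V n)),
        uspace_map phi (uact (@aact V) g v) =
        uact (@contragredient W) g (uspace_map phi v) ].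

End AsymptoticModules.

Section Cohomology.
Variables (w : nonprincipal_ultrafilter) (R : realType) (G : groupType).
Variable V : asymptotic_module w R G.

(* Points of G^m are functions 'I_m -> G. *)
Definition cochain (m : nat) : nat -> normedModType R :=
  fun n => linf ('I_m -> G) (V n).

Lemma cochain_act_subproof m n (g : G) (f : cochain m n) :
  (fun x : 'I_m -> G => @aact w R G V n g (f (fun i => (g^-1 * x i)%g)))
    \in @linf_pred R ('I_m -> G) (V n).
Proof.
apply/linf_predP; exists (linf_norm f) => x.
by rewrite aact_norm linf_normP.
Qed.

Definition cochain_act m n (g : G) (f : cochain m n) : cochain m n :=
  Linf (cochain_act_subproof g f).

Lemma cochain_d_subproof m n (f : cochain m n) :
  (fun x : 'I_m.+1 -> G =>
     \sum_(j < m.+1) (-1) ^+ j *: f (fun i => x (lift j i)))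
    \in @linf_pred R ('I_m.+1 -> G) (V n).
Proof.
apply/linf_predP; exists (\sum_(j < m.+1) linf_norm f) => x.
rewrite (le_trans (ler_norm_sum _ _ _))// ler_sum// => j _.
by rewrite normrZ normrX normrN1 expr1n mul1r linf_normP.
Qed.

(* [lift j] is the increasing injection omitting j, so that
   [fun i => x (lift j i)] is x with its j-th entry deleted. *)
Definition cochain_d m n (f : cochain m n) : cochain m.+1 n :=
  Linf (cochain_d_subproof f).

Definition tilde_act m := @tact w R G (cochain m) (@cochain_act m).

Definition tilde_d m : tilde w (cochain m) -> tilde w (cochain m.+1) :=
  tmap (@cochain_d m).

Lemma cochain_act_zmod_morphism m n g : zmod_morphism (@cochain_act m n g).
Proof.
move=> x y; apply: val_inj; apply/funext => z /=.
have := @aact_linear w R G V n g (-1).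
set p := aact g => lp.
rewrite -[LHS]/(p (x _ - y _)) -[RHS]/(p (x _) - p (y _)).
by rewrite -scaleN1r addrC lp scaleN1r addrC.
Qed.

Lemma cochain_act_norm_le m n g (f : cochain m n) :
  `|cochain_act g f| <= `|f|.
Proof.
apply: linf_norm_le => [|x]; first exact: linf_norm_ge0.
by rewrite /= aact_norm; exact: linf_normP.
Qed.

Lemma tilde_act_bounded m (g : star_group w G) :
  bounded_internal (fun n => @cochain_act m n (urepr g n)).
Proof.
split=> [n|]; first exact: cochain_act_zmod_morphism.
by exists 1 => n v; rewrite mul1r cochain_act_norm_le.
Qed.

Lemma cochain_d_bounded m : bounded_internal (@cochain_d m).
Proof.
split=> [n x y|].
  apply: val_inj; apply/funext => z /=.
  rewrite -[LHS]/(\sum_(j < m.+1) (-1) ^+ j *: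
      (x (fun i => z (lift j i)) - y (fun i => z (lift j i)))).
  under eq_bigr => j _ do rewrite scalerBr.
  by rewrite sumrB.
exists m.+1%:R => n f.
apply: linf_norm_le => [|x]; first by rewrite mulr_ge0.
rewrite (le_trans (ler_norm_sum _ _ _))//.
rewrite (@le_trans _ _ (\sum_(j < m.+1) `|f|))//.
  apply: ler_sum => j _.
  by rewrite normrZ normrX normrN1 expr1n mul1r; exact: linf_normP.
by rewrite sumr_const card_ord mulr_natl.
Qed.

Lemma tilde_actB m g : zmod_morphism (@tilde_act m g).
Proof. exact: (tmap_is_zmod_morphism (tilde_act_bounded m g)). Qed.

Lemma tilde_dB m : zmod_morphism (@tilde_d m).
Proof. exact: (tmap_is_zmod_morphism (cochain_d_bounded m)). Qed.

(* The complex starts with 0, then has the invariant (classes of) functions of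
   m + 1 variables in degree m; so degree m cocycles live on G^(m+1), and the
   coboundaries are zero in degree 0. *)
Definition invariants m : {pred tilde w (cochain m)} :=
  fun x => `[< forall g : star_group w G, tilde_act g x = x >].

Definition cocycles m : {pred tilde w (cochain m.+1)} :=
  fun x => (x \in @invariants m.+1) && (tilde_d x == 0).

Definition coboundaries m : {pred tilde w (cochain m.+1)} :=
  match m with
  | 0 => pred1 0
  | m'.+1 => fun x => `[< exists2 y, y \in @invariants m'.+1 & tilde_d y = x >]
  end.

Lemma invariants_closed m : zmod_closed (@invariants m).
Proof.
split=> [|x y /asboolP hx /asboolP hy]; apply/asboolP => g.
  by rewrite -[in LHS](subrr 0) tilde_actB subrr.
by rewrite tilde_actB hx hy.
Qed.

HB.instance Definition _ m := GRing.isZmodClosed.Build _ (@invariants m)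
  (@invariants_closed m).

Lemma cocycles_closed m : zmod_closed (@cocycles m).
Proof.
split=> [|x y /andP[hx /eqP dx] /andP[hy /eqP dy]]; apply/andP; split.
- exact: rpred0.
- by rewrite -[X in tilde_d X](subrr 0) tilde_dB subrr.
- exact: rpredB.
- by rewrite tilde_dB dx dy subrr.
Qed.

HB.instance Definition _ m := GRing.isZmodClosed.Build _ (@cocycles m)
  (@cocycles_closed m).

Lemma coboundaries_closed m : zmod_closed (@coboundaries m).
Proof.
case: m => [|m].
  by split=> [|x y /eqP-> /eqP->]; rewrite inE/= ?subrr.
split=> [|_ _ /asboolP[x hx <-] /asboolP[y hy <-]]; apply/asboolP.
  by exists 0; [exact: rpred0|rewrite -[X in tilde_d X](subrr 0) tilde_dB subrr].
by exists (x - y); [exact: rpredB|rewrite tilde_dB].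
Qed.

HB.instance Definition _ m := GRing.isZmodClosed.Build _ (@coboundaries m)
  (@coboundaries_closed m).

Record cocycle m := Cocycle {
  cocycle_val : tilde w (cochain m.+1) ;
  cocycleP : cocycle_val \in @cocycles m }.

HB.instance Definition _ m := [isSub for @cocycle_val m].
HB.instance Definition _ m := [Choice of cocycle m by <:].
HB.instance Definition _ m := [SubChoice_isSubZmodule of cocycle m by <:].

Definition cocycle_coboundaries m : {pred cocycle m} :=
  fun z => val z \in @coboundaries m.

Lemma cocycle_coboundaries_closed m : zmod_closed (@cocycle_coboundaries m).
Proof.
split=> [|x y]; rewrite /in_mem /= /cocycle_coboundaries.
  by rewrite raddf0 rpred0.
by rewrite raddfB; exact: rpredB.
Qed.

HB.instance Definition _ m := GRing.isZmodClosed.Build _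
  (@cocycle_coboundaries m) (@cocycle_coboundaries_closed m).

(* [Quotient.quot] is the quotient of an additive group by a subgroup. *)
Definition asymptotic_cohomology m := Quotient.quot (@cocycle_coboundaries m).
HB.instance Definition _ m := GRing.Zmodule.on (asymptotic_cohomology m).

End Cohomology.

Section Lamplighter.
Variables Gamma Lambda : groupType.
Local Open Scope group_scope.

(* The lamplighter group is the restricted wreath product of Gamma by Lambda,
   where s in Lambda acts on f by (s . f) x = f (s^-1 x). *)
Record lamplighter := Lamplighter {
  lamps : {fsfun Lambda -> Gamma with 1} ;
  lamp_shift : Lambda }.

Definition pair_of_lamplighter (u : lamplighter) := (lamps u, lamp_shift u).
Definition lamplighter_of_pair (p : {fsfun Lambda -> Gamma with 1} * Lambda) :=
  Lamplighter p.1 p.2.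
Lemma pair_of_lamplighterK : cancel pair_of_lamplighter lamplighter_of_pair.
Proof. by case. Qed.

HB.instance Definition _ := Choice.copy lamplighter
  (can_type pair_of_lamplighterK).

Definition shift_lamps (s : Lambda) (f : {fsfun Lambda -> Gamma with 1}) :
    {fsfun Lambda -> Gamma with 1} :=
  [fsfun x in [fset s * y | y in finsupp f]%fset => f (s^-1 * x) | 1].

Definition mul_lamps (f g : {fsfun Lambda -> Gamma with 1}) :
    {fsfun Lambda -> Gamma with 1} :=
  [fsfun x in (finsupp f `|` finsupp g)%fset => f x * g x | 1].

Definition inv_lamps (f : {fsfun Lambda -> Gamma with 1}) :
    {fsfun Lambda -> Gamma with 1} :=
  [fsfun x in finsupp f => (f x)^-1 | 1].

Lemma shift_lampsE s f x : shift_lamps s f x = f (s^-1 * x).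
Proof.
rewrite /shift_lamps fsfunE; case: ifPn => // /imfsetP h.
case: (finsuppP f (s^-1 * x)) => // hx; case: h.
by exists (s^-1 * x) => //; rewrite mulVKg.
Qed.

Lemma mul_lampsE f g x : mul_lamps f g x = f x * g x.
Proof.
rewrite /mul_lamps fsfunE !inE; case: ifPn => //; rewrite negb_or => /andP[hf hg].
by rewrite !fsfun_dflt// mulg1.
Qed.

Lemma inv_lampsE f x : inv_lamps f x = (f x)^-1.
Proof.
rewrite /inv_lamps fsfunE; case: ifPn => // hf.
by rewrite fsfun_dflt// invg1.
Qed.

Definition lamplighter_one := Lamplighter [fsfun of _ => 1] 1.

Definition lamplighter_mul (u v : lamplighter) :=
  Lamplighter (mul_lamps (lamps u) (shift_lamps (lamp_shift u) (lamps v)))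
              (lamp_shift u * lamp_shift v).

Definition lamplighter_inv (u : lamplighter) :=
  Lamplighter (shift_lamps (lamp_shift u)^-1 (inv_lamps (lamps u)))
              (lamp_shift u)^-1.

Let lampsP := (mul_lampsE, shift_lampsE, inv_lampsE, fsfun0E).

Lemma lamplighter_mulA : associative lamplighter_mul.
Proof.
move=> [f s] [g t] [h r]; rewrite /lamplighter_mul /= mulgA.
congr Lamplighter; apply/fsfunP => x.
by rewrite !lampsP mulgA invgM mulgA.
Qed.

Lemma lamplighter_mul1g : left_id lamplighter_one lamplighter_mul.
Proof.
move=> [f s]; rewrite /lamplighter_mul /= mul1g.
by congr Lamplighter; apply/fsfunP => x; rewrite !lampsP invg1 !mul1g.
Qed.

Lemma lamplighter_mulg1 : right_id lamplighter_one lamplighter_mul.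
Proof.
move=> [f s]; rewrite /lamplighter_mul /= mulg1.
by congr Lamplighter; apply/fsfunP => x; rewrite !lampsP mulg1.
Qed.

Lemma lamplighter_mulVg :
  left_inverse lamplighter_one lamplighter_inv lamplighter_mul.
Proof.
move=> [f s]; rewrite /lamplighter_mul /= mulVg.
by congr Lamplighter; apply/fsfunP => x; rewrite !lampsP mulVg.
Qed.

Lemma lamplighter_mulgV :
  right_inverse lamplighter_one lamplighter_inv lamplighter_mul.
Proof.
move=> [f s]; rewrite /lamplighter_mul /= mulgV.
congr Lamplighter; apply/fsfunP => x.
by rewrite !lampsP invgK mulVKg mulgV.
Qed.

HB.instance Definition _ := isGroup.Build lamplighter lamplighter_mulA
  lamplighter_mul1g lamplighter_mulg1 lamplighter_mulVg lamplighter_mulgV.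

End Lamplighter.

(* Existence of a left-invariant mean on the bounded real functions. *)
Definition amenable (R : realType) (G : groupType) :=
  exists mean : linf G R^o -> R^o,
  [/\ linear mean,
      forall f : linf G R^o, (forall x, f x = 1) -> mean f = 1,
      forall f : linf G R^o, (forall x, 0 <= f x) -> 0 <= mean f &
      forall (g : G) (f f' : linf G R^o),
        (forall x, f' x = f (g^-1 * x)%g) -> mean f' = mean f ].

(* Main.v *)
(** Write G for the lamplighter group and N for its subgroup of lamp
    configurations.  Averaging a cochain over right translates of its arguments,
    independently in each argument, changes it by an (explicit, equivariant)
    prism coboundary; values in a dual space can be averaged by any mean, and
    these averages commute with the contragredient maps.  A first average, over
    the amenable group Lambda, makes a cocycle f right Lambda-invariant, hence a
    function phi of the lamp configurations of its arguments, which is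
    almost Lambda-equivariant for the shift.  A second average is over random
    configurations, i.i.d. on a large finite set of sites chosen by a
    Lambda-invariant mean, but trivial on a finite set A absorbing the lamps of
    the given arguments.

    This second average is almost constant.  Indeed it is a conditional
    expectation of phi given a pattern on A; by equivariance it has, up to a small
    error and the isometries by Lambda, the same distance to the mean C of phi as
    the expectations given the translated patterns on disjoint translates s_i A.
    These events are independent of the same probability q > 0, so by the law of
    large numbers the differences average to 0 in every coordinate.  As
    the coefficients are finite-dimensional, finitely many coordinates control
    the norm, and the difference is at most twice the defect of equivariance,
    whatever q and the dimension are.  Finally a constant cochain is a coboundary
    in even degree and is not a cocycle in odd degree, unless it is small.  All
    constants depend on the degree only, so that the construction passes to the
    ultraproduct. *)

Require Import Defs.
From HB Require Import structures.
From mathcomp Require Import all_boot all_order all_algebra.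
From mathcomp Require Import finmap.
From mathcomp Require Import all_classical all_reals topology normedtype.
From mathcomp Require Import ring lra.

Set Implicit Arguments.
Unset Strict Implicit.
Unset Printing Implicit Defensive.

Import Order.TTheory GRing.Theory Num.Theory.
Import numFieldNormedType.Exports.

Local Open Scope classical_set_scope.
Local Open Scope ring_scope.

(** * Means *)

Section Means.
Variable R : realType.

Definition bounded_real (X : Type) (f : X -> R) :=
  exists M : R, forall x, `|f x| <= M.

Lemma bounded_real_cst (X : Type) (c : R) : bounded_real (fun _ : X => c).
Proof. by exists `|c|. Qed.

Lemma bounded_realD (X : Type) (f g : X -> R) :
  bounded_real f -> bounded_real g -> bounded_real (fun x => f x + g x).
Proof.
move=> [M hM] [N hN]; exists (M + N) => x.
by rewrite (le_trans (ler_normD _ _))// lerD.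
Qed.

Lemma bounded_realM (X : Type) (f g : X -> R) :
  bounded_real f -> bounded_real g -> bounded_real (fun x => f x * g x).
Proof.
move=> [M hM] [N hN]; exists (M * N) => x.
by rewrite normrM ler_pM.
Qed.

Lemma bounded_realN (X : Type) (f : X -> R) :
  bounded_real f -> bounded_real (fun x => - f x).
Proof. by move=> [M hM]; exists M => x; rewrite normrN. Qed.

Lemma bounded_real_comp (X Y : Type) (g : X -> Y) (f : Y -> R) :
  bounded_real f -> bounded_real (fun x => f (g x)).
Proof. by move=> [M hM]; exists M => x. Qed.

Lemma bounded_real_sum (X : Type) (I : Type) (s : seq I) (f : I -> X -> R) :
  (forall i, bounded_real (f i)) -> bounded_real (fun x => \sum_(i <- s) f i x).
Proof.
move=> bf; elim: s => [|i s IH].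
  by exists 0 => x; rewrite big_nil normr0.
have [M hM] := bounded_realD (bf i) IH.
by exists M => x; rewrite big_cons.
Qed.

(* Only the values on bounded functions matter. *)
Record mean (X : Type) := Mean {
  mean_fun :> (X -> R) -> R ;
  mean_linear : forall a f g, bounded_real f -> bounded_real g ->
    mean_fun (fun x => a * f x + g x) = a * mean_fun f + mean_fun g ;
  mean_ge0 : forall f, bounded_real f -> (forall x, 0 <= f x) ->
    0 <= mean_fun f ;
  mean_one : mean_fun (fun=> 1) = 1 }.

Section Theory.
Variables (X : Type) (P : mean X).
Implicit Types f g : X -> R.

Lemma mean0 : P (fun=> 0) = 0.
Proof.
have := mean_linear P 1 (bounded_real_cst X 0) (bounded_real_cst X 0).
under eq_fun do rewrite mulr0 addr0.
by rewrite mul1r => /eqP; rewrite -subr_eq subrr eq_sym => /eqP.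
Qed.

Lemma meanD f g : bounded_real f -> bounded_real g ->
  P (fun x => f x + g x) = P f + P g.
Proof.
move=> bf bg; have := mean_linear P 1 bf bg.
by under eq_fun do rewrite mul1r; rewrite mul1r.
Qed.

Lemma meanZ a f : bounded_real f -> P (fun x => a * f x) = a * P f.
Proof.
move=> bf; have := mean_linear P a bf (bounded_real_cst X 0).
by under eq_fun do rewrite addr0; rewrite mean0 addr0.
Qed.

Lemma meanN f : bounded_real f -> P (fun x => - f x) = - P f.
Proof.
move=> bf; rewrite -mulN1r -meanZ//; congr mean_fun.
by apply/funext => x; rewrite mulN1r.
Qed.

Lemma meanB f g : bounded_real f -> bounded_real g ->
  P (fun x => f x - g x) = P f - P g.
Proof. by move=> bf bg; rewrite meanD ?meanN//; exact: bounded_realN. Qed.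

Lemma mean_cst a : P (fun=> a) = a.
Proof.
have := meanZ a (bounded_real_cst X 1); by rewrite mean_one mulr1.
Qed.

Lemma mean_le f g : bounded_real f -> bounded_real g ->
  (forall x, f x <= g x) -> P f <= P g.
Proof.
move=> bf bg fg; rewrite -subr_ge0 -meanB//; apply: mean_ge0.
  by apply: bounded_realD => //; exact: bounded_realN.
by move=> x; rewrite subr_ge0.
Qed.

Lemma mean_sum (I : Type) (s : seq I) (F : I -> X -> R) :
  (forall i, bounded_real (F i)) ->
  P (fun x => \sum_(i <- s) F i x) = \sum_(i <- s) P (F i).
Proof.
move=> bF; elim: s => [|i s IH].
  by under eq_fun do rewrite big_nil; rewrite mean0 big_nil.
under eq_fun do rewrite big_cons.
by rewrite meanD// ?big_cons ?IH//; exact: bounded_real_sum.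
Qed.

Lemma mean_norm_le f M : (forall x, `|f x| <= M) -> `|P f| <= M.
Proof.
move=> fM; have bf : bounded_real f by exists M.
have h x : - M <= f x <= M by rewrite -ler_norml.
rewrite ler_norml -{1}(mean_cst (- M)) -{2}(mean_cst M); apply/andP; split.
  by apply: mean_le => // [|x]; [exact: bounded_real_cst|case/andP: (h x)].
by apply: mean_le => // [|x]; [exact: bounded_real_cst|case/andP: (h x)].
Qed.

End Theory.

Section Dirac.
Variables (X : Type) (x0 : X).

Definition mean_dirac : mean X :=
  @Mean X (fun f => f x0) (fun _ _ _ _ _ => erefl) (fun _ _ f0 => f0 x0) erefl.

End Dirac.

Section Bind.
Variables (X Y : Type) (P : mean X) (Q : X -> mean Y).

(** Means are only finitely additive, so iterated means need not commute: [P] is always the outer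
    one. *)
Definition bind_fun (f : Y -> R) := P (fun x => Q x f).

Lemma bind_bounded (f : Y -> R) : bounded_real f ->
  bounded_real (fun x => Q x f).
Proof. by move=> [M hM]; exists M => x; exact: mean_norm_le. Qed.

Lemma bind_linear a f g : bounded_real f -> bounded_real g ->
  bind_fun (fun x => a * f x + g x) = a * bind_fun f + bind_fun g.
Proof.
move=> bf bg; rewrite /bind_fun -mean_linear; try exact: bind_bounded.
by congr mean_fun; apply/funext => x; rewrite mean_linear.
Qed.

Lemma bind_ge0 f : bounded_real f -> (forall x, 0 <= f x) -> 0 <= bind_fun f.
Proof.
move=> bf f0; apply: mean_ge0 => [|x]; first exact: bind_bounded.
exact: mean_ge0.
Qed.

Lemma bind_one : bind_fun (fun=> 1) = 1.
Proof. by rewrite /bind_fun; under eq_fun do rewrite mean_one; exact: mean_one. Qed.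

Definition mean_bind : mean Y := Mean bind_linear bind_ge0 bind_one.

End Bind.

Definition mean_push (X Y : Type) (t : X -> Y) (P : mean X) : mean Y :=
  mean_bind P (fun x => mean_dirac (t x)).

Section Uniform.
Variables (X : Type) (x0 : X) (s : seq X).

(** The list is given as [x0 :: s] so that it is never empty. *)
Definition uniform_fun (f : X -> R) :=
  (\sum_(x <- x0 :: s) f x) / (size s).+1%:R.

Lemma uniform_linear a f g : bounded_real f -> bounded_real g ->
  uniform_fun (fun x => a * f x + g x) = a * uniform_fun f + uniform_fun g.
Proof.
by move=> _ _; rewrite /uniform_fun big_split/= -mulr_sumr mulrDl mulrA.
Qed.

Lemma uniform_ge0 f : bounded_real f -> (forall x, 0 <= f x) ->
  0 <= uniform_fun f.
Proof. by move=> _ f0; rewrite divr_ge0// sumr_ge0. Qed.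

Lemma uniform_one : uniform_fun (fun=> 1) = 1.
Proof.
by rewrite /uniform_fun big_const_seq count_predT iter_addr_0 divff// pnatr_eq0.
Qed.

Definition mean_uniform : mean X := Mean uniform_linear uniform_ge0 uniform_one.

End Uniform.

(** * Means as limits along ultrafilters *)

Section UltraLimit.
Variables (X : Type) (U : set_system X).
Hypothesis ultraU : UltraFilter U.

(** The image of [U] under [f] is an ultrafilter containing the segment from [- M] to [M], which is
    compact. *)
Lemma ultra_cvg (f : X -> R) : bounded_real f -> cvg (f @ U).
Proof.
move=> [M hM].
have UF : UltraFilter (f @ U).
  split; first exact: fmap_proper_filter.
  move=> G PG sUG; apply/seteqP; split=> // A GA.
  have [//|UA] := in_ultra_setVsetC (f @^-1` A) ultraU.
  have /(filterI GA) : G (~` A) by apply: sUG.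
  by rewrite setICr => /filter_ex[].
have := @segment_compact R (- M) M; rewrite compact_ultra => /(_ _ UF).
case; last by move=> l [_ Fl]; apply/cvg_ex; exists l.
apply: (@filterE _ U _) => x /=.
by rewrite in_itv/= -ler_norml.
Qed.

Definition limit_fun (f : X -> R) : R := lim (f @ U).

Lemma limit_linear a f g : bounded_real f -> bounded_real g ->
  limit_fun (fun x => a * f x + g x) = a * limit_fun f + limit_fun g.
Proof.
move=> /ultra_cvg cf /ultra_cvg cg; apply/cvg_lim => //.
by apply: cvgD => //; apply: cvgMr.
Qed.

Lemma limit_ge0 f : bounded_real f -> (forall x, 0 <= f x) -> 0 <= limit_fun f.
Proof.
by move=> /ultra_cvg cf f0; apply: limr_ge => //; exact: filterE.
Qed.

Lemma limit_one : limit_fun (fun=> 1) = 1.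
Proof. by apply/cvg_lim => //; exact: cvg_cst. Qed.

Definition mean_limit : mean X := Mean limit_linear limit_ge0 limit_one.

Lemma mean_limit_le (f : X -> R) (M : R) : bounded_real f ->
  U [set x | f x <= M] -> mean_limit f <= M.
Proof. by move=> /ultra_cvg cf; exact: limr_le. Qed.

End UltraLimit.

Section Directed.
Variables (X : Type) (le : X -> X -> Prop).
Hypothesis le_refl : forall x, le x x.
Hypothesis le_trans : forall x y z, le x y -> le y z -> le x z.
Hypothesis le_directed : forall x y, exists2 z, le x z & le y z.

(** By directedness the cones above the points generate a filter, and [L] is the limit along an
    ultrafilter refining it. Used for [f] and for its opposite, the bound says that [L] only sees
    what happens eventually. *)
Lemma directed_mean (x0 : X) : exists L : mean X,
  forall x (f : X -> R) (M : R), bounded_real f ->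
    (forall y, le x y -> f y <= M) -> L f <= M.
Proof.
pose F : set_system X := fun A => exists x, forall y, le x y -> A y.
have FF : ProperFilter F.
  split.
    by case=> x /(_ x (le_refl x)).
  split; first by exists x0.
    move=> A B [x hx] [y hy]; have [z xz yz] := le_directed x y.
    exists z => t zt; split; [apply: hx|apply: hy].
      exact: (le_trans xz zt).
    exact: (le_trans yz zt).
  by move=> A B AB [x hx]; exists x => y xy; apply/AB/hx.
have [U [UU sFU]] := ultraFilterLemma FF.
exists (mean_limit UU) => x f M bf h.
by apply: mean_limit_le => //; apply: sFU; exists x.
Qed.

End Directed.

Lemma amenable_mean (G : groupType) : amenable R G ->
  exists L : mean G, forall (g : G) (f : G -> R), bounded_real f ->
    L (fun x => f (g * x)%g) = L f.
Proof.
move=> [m [mlin m1 m0 minv]].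
(* A [mean] is applied to all functions, an invariant mean on [linf] to bounded ones: unbounded
   functions are sent to 0. *)
have lift_ex (f : G -> R) : exists F : linf G R^o, bounded_real f -> forall x, F x = f x.
  have [bf|nbf] := pselect (bounded_real f); last by exists 0.
  have hf : (f : G -> R^o) \in @linf_pred R G R^o by apply/linf_predP.
  by exists (Linf hf).
have [T hT] := choice lift_ex.
have mE (f g : linf G R^o) : (forall x, f x = g x) -> m f = m g.
  by move=> fg; congr m; apply: val_inj; apply/funext.
have lin a f g : bounded_real f -> bounded_real g ->
    m (T (fun x => a * f x + g x)) = a * m (T f) + m (T g).
  move=> bf bg; rewrite -[RHS]mlin; apply: mE => x.
  rewrite hT /=; last first.
    apply: bounded_realD => //.
    by apply: bounded_realM => //; exact: bounded_real_cst.
  by rewrite -[RHS]/(a * T f x + T g x) !hT.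
have ge0 f : bounded_real f -> (forall x, 0 <= f x) -> 0 <= m (T f).
  by move=> bf f0; apply: m0 => x; rewrite hT.
have one : m (T (fun=> 1)) = 1.
  by apply: m1 => x; rewrite hT//; exact: bounded_real_cst.
exists (Mean lin ge0 one) => g f bf /=.
apply: (minv g^-1%g) => x; rewrite !hT ?invgK//.
exact: bounded_real_comp.
Qed.

End Means.

(** * Cochains on lists and the prism homotopy *)

Section ListCochains.
Variables (R : realType) (T : Type).

(** Cochains are functions on lists of all lengths, so that identities between faces can be proved
    by induction on the list; [delete j] is the j-th face map. *)
Fixpoint delete (X : Type) (j : nat) (s : seq X) : seq X :=
  match s, j with
  | [::], _ => [::]
  | _ :: s', 0%N => s'
  | x :: s', j'.+1 => x :: delete j' s'
  end.

Lemma size_delete (X : Type) (j : nat) (s : seq X) :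
  (j < size s)%N -> size (delete j s) = (size s).-1.
Proof.
elim: s j => [|x s IH] [|j]//=; rewrite ltnS => js.
by rewrite IH//; case: s js {IH}.
Qed.

Lemma delete_map (X Y : Type) (h : X -> Y) (j : nat) (s : seq X) :
  delete j (map h s) = map h (delete j s).
Proof. by elim: s j => [|x s IH] [|j]//=; rewrite IH. Qed.

Lemma delete_zip (X Y : Type) (j : nat) (s : seq X) (t : seq Y) :
  delete j (zip s t) = zip (delete j s) (delete j t).
Proof.
elim: s t j => [|x s IH] [|y t] [|j]//=; last by rewrite IH.
  by case: t.
by case: s {IH}.
Qed.

Lemma nth_delete (X : Type) (x0 : X) (j : nat) (s : seq X) (i : nat) :
  (j < size s)%N -> nth x0 (delete j s) i = nth x0 s (bump j i).
Proof.
elim: s j i => [|x s IH] [|j] [|i]//= js.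
by rewrite IH// bumpS.
Qed.

Variable U : lmodType R.
Implicit Types (F : seq T -> U) (s a b : seq T).

Definition coboundary F s : U :=
  \sum_(j < size s) (-1) ^+ j *: F (delete j s).

Lemma coboundary_nil F : coboundary F [::] = 0.
Proof. by rewrite /coboundary big_ord0. Qed.

(** The face deleting the head comes first; the others keep [x], and their index, hence their sign,
    is shifted by one. *)
Lemma coboundary_cons F x s :
  coboundary F (x :: s) = F s - coboundary (fun t => F (x :: t)) s.
Proof.
rewrite /coboundary big_ord_recl /= expr0 scale1r -sumrN; congr (_ + _).
by apply: eq_bigr => j _; rewrite exprS mulN1r scaleNr.
Qed.

Lemma coboundaryB F F' s :
  coboundary (fun t => F t - F' t) s = coboundary F s - coboundary F' s.
Proof.
by rewrite /coboundary -sumrB; apply: eq_bigr => j _; rewrite scalerBr.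
Qed.

Lemma coboundaryD F F' s :
  coboundary (fun t => F t + F' t) s = coboundary F s + coboundary F' s.
Proof.
by rewrite /coboundary -big_split; apply: eq_bigr => j _; rewrite scalerDr.
Qed.

Lemma coboundary_cst (u : U) s :
  coboundary (fun=> u) s = if odd (size s) then u else 0.
Proof.
elim: s => [|x s IH]; first by rewrite coboundary_nil.
by rewrite coboundary_cons IH /=; case: odd; rewrite /= ?subrr ?subr0.
Qed.

(** The prism operator of simplicial homology, the sum over i of [(-1) ^+ i] times the value of [F]
    at a_0, ..., a_i, b_i, ..., b_n. *)
Fixpoint prism F a b : U :=
  match a, b with
  | x :: a', y :: b' =>
      F [:: x, y & b'] - prism (fun s => F (x :: s)) a' b'
  | _, _ => 0
  end.

Definition coboundary2 (H : seq T -> seq T -> U) a b : U :=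
  \sum_(j < size a) (-1) ^+ j *: H (delete j a) (delete j b).

Lemma coboundary2_cons H x y a b :
  coboundary2 H (x :: a) (y :: b) =
  H a b - coboundary2 (fun a' b' => H (x :: a') (y :: b')) a b.
Proof.
rewrite /coboundary2 big_ord_recl /= expr0 scale1r -sumrN; congr (_ + _).
by apply: eq_bigr => j _; rewrite exprS mulN1r scaleNr.
Qed.

Lemma eq_prism F F' a b : F =1 F' -> prism F a b = prism F' a b.
Proof. by move=> FF'; congr prism; apply/funext. Qed.

Lemma prismB F F' a b :
  prism (fun s => F s - F' s) a b = prism F a b - prism F' a b.
Proof.
elim: a b F F' => [|x a IH] [|y b] F F' /=; rewrite ?subrr//.
by rewrite (IH b (fun s => F (x :: s)) (fun s => F' (x :: s))) !opprD !opprK addrACA.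
Qed.

Lemma coboundary2B H H' a b :
  coboundary2 (fun a' b' => H a' b' - H' a' b') a b =
  coboundary2 H a b - coboundary2 H' a b.
Proof.
by rewrite /coboundary2 -sumrB; apply: eq_bigr => j _; rewrite scalerBr.
Qed.

Lemma coboundary2r F a b : size a = size b ->
  coboundary2 (fun _ b' => F b') a b = coboundary F b.
Proof. by rewrite /coboundary2 /coboundary => ->. Qed.

(** The discrete form of the fact that a prism is bounded by its two ends and its sides. Induction
    on the lists, with the hypothesis used for [F (x :: _)]. *)
Lemma prism_homotopy F a b : size a = size b ->
  coboundary2 (prism F) a b + prism (coboundary F) a b = F b - F a.
Proof.
elim: a b F => [|x a IH] [|y b] F //=.
  by rewrite /coboundary2 big_ord0 subrr addr0.
move=> [sab]; rewrite coboundary2_cons /=.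
rewrite (coboundary2B (fun _ b' => F [:: x, y & b'])) coboundary2r//.
have -> : prism (fun s => coboundary F (x :: s)) a b =
    prism F a b - prism (coboundary (fun t => F (x :: t))) a b.
  by rewrite -prismB; apply: eq_prism => s; rewrite coboundary_cons.
rewrite !coboundary_cons.
have := IH b (fun t => F (x :: t)) sab.
(* With all terms generalized, an identity in an abelian group remains; [qr] is the induction
   hypothesis. *)
move: (prism F a b) (coboundary _ b) (prism (coboundary _) a b).
move: (coboundary2 _ a b) (F (y :: b)) (F (x :: b)) (F (x :: a)).
move=> q d e e' p c r qr.
rewrite !opprB (addrC p) -!addrA (addrC r) (addrCA (- e) (- p)).
rewrite (addrCA c (- p)) (addrCA d (- p)) addNKr (addrCA d c) addKr.
by rewrite addrCA [- e + r]addrC [q + _]addrA qr addrAC subrr add0r.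
Qed.

End ListCochains.

(** * Averaging cochains with values in a dual space *)

Section ProductMean.
Variables (R : realType) (X : Type) (p : mean R X).

(** Independent entries of law [p], as an iterated mean with the first entry outermost. *)
Fixpoint product_mean (m : nat) : mean R (seq X) :=
  match m with
  | 0%N => mean_dirac R [::]
  | m'.+1 => mean_bind p (fun x => mean_push (cons x) (product_mean m'))
  end.

Lemma eq_product_mean m (f f' : seq X -> R) :
  (forall s, size s = m -> f s = f' s) -> product_mean m f = product_mean m f'.
Proof.
elim: m f f' => [|m IH] f f' ff'; first exact: ff'.
congr (mean_fun p); apply/funext => x; apply: IH => s sm.
by apply: ff'; rewrite /= sm.
Qed.

(** The deleted entry is averaged out of a function that does not depend on it. This compatibility
    of marginals makes averaging commute with coboundaries. *)
Lemma product_mean_delete m j (f : seq X -> R) : (j <= m)%N ->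
  product_mean m.+1 (fun s => f (delete j s)) = product_mean m f.
Proof.
elim: j m f => [|j IH] m f jm; first by rewrite -[RHS](mean_cst p).
case: m jm => // m jm.
congr (mean_fun p); apply/funext => x.
exact: (IH m (fun s => f (x :: s)) jm).
Qed.

End ProductMean.

Lemma product_mean_push (R : realType) (X Y : Type) (t : X -> Y) (p : mean R X) m
    (f : seq Y -> R) :
  product_mean (mean_push t p) m f = product_mean p m (fun s => f (map t s)).
Proof.
elim: m f => // m IH f; congr (mean_fun p); apply/funext => x.
exact: (IH (fun s => f (t x :: s))).
Qed.

Section DualMean.
Variables (R : realType) (W : normedModType R).

Lemma cdual_ext (u v : cdual W) : (forall x, u x = v x) -> u = v.
Proof. by move=> uv; apply: val_inj; apply/funext. Qed.

Lemma cdual_op_norm (u : cdual W) x : `|u x| <= `|u| * `|x|.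
Proof.
have [->|x0] := eqVneq x 0; first by rewrite cdual0 !normr0 mulr0.
have nx : 0 < `|x| by rewrite normr_gt0.
rewrite -ler_pdivrMr//.
have -> : `|u x| / `|x| = `|u (`|x|^-1 *: x)|.
  rewrite -[_ *: x]addr0 (cdual_linear u) cdual0 addr0.
  by rewrite [RHS]normrM normfV normr_id mulrC.
apply: cdual_normP; rewrite normrZ normfV normr_id mulVf//.
by rewrite gt_eqF.
Qed.

Lemma cdual_norm_bound (u : cdual W) (M : R) : 0 <= M ->
  (forall x, `|u x| <= M * `|x|) -> `|u| <= M.
Proof.
move=> M0 h; apply: cdual_norm_le => x x1; rewrite (le_trans (h x))//.
by rewrite -[leRHS]mulr1 ler_wpM2l.
Qed.

Lemma cdualBE (u v : cdual W) x : (u - v) x = u x - v x.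
Proof. by []. Qed.

Lemma cdualDE (u v : cdual W) x : (u + v) x = u x + v x.
Proof. by []. Qed.

Lemma cdualNE (u : cdual W) x : (- u) x = - u x.
Proof. by []. Qed.

Lemma cdual_sumE (I : Type) (s : seq I) (F : I -> cdual W) x :
  (\sum_(i <- s) F i) x = \sum_(i <- s) F i x.
Proof.
elim: s => [|i s IH]; first by rewrite !big_nil.
by rewrite !big_cons -IH.
Qed.

Variables (X : Type) (P : mean R X).
Implicit Types F : X -> cdual W.

Definition bounded_family F := exists M : R, forall x, `|F x| <= M.

Lemma bounded_family_eval F w : bounded_family F ->
  bounded_real (fun x => F x w).
Proof.
move=> [M h]; exists (M * `|w|) => x.
by rewrite (le_trans (cdual_op_norm _ _))// ler_wpM2r.
Qed.

(* [0] is a junk value, for unbounded families. *)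
Definition dual_mean F : cdual W :=
  insubd (0 : cdual W) (fun w => P (fun x => F x w) : R^o).

(** The average is a weak-star one: the mean of the values at [w] is linear in [w], and it is
    bounded because the family is. *)
Lemma dual_meanE F w : bounded_family F ->
  dual_mean F w = P (fun x => F x w).
Proof.
move=> bF; rewrite /dual_mean.
suff h : ((fun w => P (fun x => F x w)) : W -> R^o) \in @cdual_pred R W.
  by rewrite -[LHS]/(val _ w) (insubdK _ h).
pose q : W -> R^o := fun w => P (fun x => F x w).
have lin : linear q.
  move=> a x y; rewrite -[RHS]/(a * q x + q y) -mean_linear.
  - by congr (mean_fun P); apply/funext => z; rewrite cdual_linear.
  - exact: bounded_family_eval.
  - exact: bounded_family_eval.
apply/asboolP; split; first exact: lin.
pose l : {linear W -> R^o} := HB.pack q (GRing.isLinear.Build _ _ _ _ q lin).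
have : continuous l; last by [].
apply/linear_bounded_continuous/linear_boundedP.
have [M hM] := bF; exists `|M|; split; first exact: num_real.
move=> r Mr x /=; rewrite /q; apply: mean_norm_le => z.
rewrite (le_trans (cdual_op_norm _ _))// ler_wpM2r// (le_trans (hM _))//.
by rewrite ltW// (le_lt_trans (ler_norm _)).
Qed.

Lemma dual_mean_norm F M : 0 <= M -> (forall x, `|F x| <= M) ->
  `|dual_mean F| <= M.
Proof.
move=> M0 h; apply: cdual_norm_bound => // w.
rewrite dual_meanE; last by exists M.
apply: mean_norm_le => x.
by rewrite (le_trans (cdual_op_norm _ _))// ler_wpM2r.
Qed.

Lemma bounded_familyB F F' : bounded_family F -> bounded_family F' ->
  bounded_family (fun x => F x - F' x).
Proof.
move=> [M h] [M' h']; exists (M + M') => x.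
by rewrite (le_trans (ler_normB _ _))// lerD.
Qed.

Lemma dual_meanB F F' : bounded_family F -> bounded_family F' ->
  dual_mean (fun x => F x - F' x) = dual_mean F - dual_mean F'.
Proof.
move=> bF bF'; apply: cdual_ext => w.
rewrite cdualBE !dual_meanE//; last exact: bounded_familyB.
by rewrite -meanB//; exact: bounded_family_eval.
Qed.

Lemma dual_mean_cst (u : cdual W) : dual_mean (fun=> u) = u.
Proof.
apply: cdual_ext => w; rewrite dual_meanE ?mean_cst//.
by exists `|u|.
Qed.

Lemma dual_mean_dist F (F' : X -> cdual W) M : 0 <= M ->
  bounded_family F -> bounded_family F' ->
  (forall x, `|F x - F' x| <= M) -> `|dual_mean F - dual_mean F'| <= M.
Proof. by move=> M0 bF bF' h; rewrite -dual_meanB//; exact: dual_mean_norm. Qed.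

End DualMean.

Definition translate (G : groupType) (k : G) (g : seq G) : seq G :=
  [seq (k * x)%g | x <- g].

Lemma size_translate (G : groupType) (k : G) (g : seq G) :
  size (translate k g) = size g.
Proof. exact: size_map. Qed.

(** * Averaging near-cocycles, and the homotopy to the identity *)

Section Averaging.
Variables (R : realType) (W : normedModType R) (G : groupType).
Variables (r : G -> W -> W) (rho : G -> cdual W -> cdual W).
Hypothesis rhoE : forall g u w, rho g u w = u (r g w).
Hypothesis rho_norm : forall g u, `|rho g u| = `|u|.
Implicit Types (f : seq G -> cdual W) (g : seq G).

Lemma rhoB k u v : rho k (u - v) = rho k u - rho k v.
Proof. by apply: cdual_ext => w; rewrite rhoE !cdualBE !rhoE. Qed.

Lemma rho0 k : rho k 0 = 0.
Proof. by have := rhoB k 0 0; rewrite !subrr. Qed.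

(** Transposes of maps of [W] commute with pointwise averages over [W]. *)
Lemma dual_mean_rho (X : Type) (P : mean R X) (F : X -> cdual W) k :
  bounded_family F -> dual_mean P (fun x => rho k (F x)) = rho k (dual_mean P F).
Proof.
move=> bF; apply: cdual_ext => w.
rewrite rhoE !dual_meanE//; last by case: bF => M h; exists M => x; rewrite rho_norm.
by congr (mean_fun P); apply/funext => x; rewrite rhoE.
Qed.

(** The bounds are uniform over lists of every length; a cochain of a fixed length is extended by 0,
    see [list_cochain]. *)
Record near_cocycle f (M e : R) : Prop := NearCocycle {
  near_bounded : forall g, `|f g| <= M ;
  near_equivariant : forall k g, `|rho k (f g) - f (translate k g)| <= e ;
  near_closed : forall g, `|coboundary f g| <= e }.

Lemma prism_norm f M (a b : seq G) : (forall g, `|f g| <= M) ->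
  `|prism f a b| <= (size a)%:R * M.
Proof.
have := normr_ge0 (f [::]).
elim: a b f => [|x a IH] [|y b] f M0 hM //=; rewrite ?normr0 ?mul0r//.
  by rewrite mulr_ge0// (le_trans (normr_ge0 (f [::]))).
rewrite (le_trans (ler_normB _ _))// -natr1 mulrDl mul1r addrC lerD//.
by apply: IH => //; exact: normr_ge0.
Qed.

Lemma prism_rho f k (a b : seq G) :
  prism (fun s => rho k (f s)) a b = rho k (prism f a b).
Proof.
elim: a b f => [|x a IH] [|y b] f /=; rewrite ?rho0//.
by rewrite rhoB -IH.
Qed.

Lemma prism_map f (h : G -> G) (a b : seq G) :
  prism f (map h a) (map h b) = prism (fun s => f (map h s)) a b.
Proof.
elim: a b f => [|x a IH] [|y b] f //=.
by rewrite -(IH b (fun s => f (h x :: s))).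
Qed.

Variables (X : Type) (act : G -> X -> G).
Hypothesis actM : forall k y x, act (k * y)%g x = (k * act y x)%g.
Variable P : nat -> mean R (seq X).
Hypothesis P_size : forall m (f f' : seq X -> R),
  (forall s, size s = m -> f s = f' s) -> P m f = P m f'.
Hypothesis P_delete : forall m j (f : seq X -> R), bounded_real f ->
  (j <= m)%N -> P m.+1 (fun s => f (delete j s)) = P m f.

(** Each entry of [g] is moved by its own entry of [x]. By [actM] this commutes with left
    translation, as right translations do. *)
Definition act_seq g (x : seq X) : seq G :=
  [seq act q.1 q.2 | q <- zip g x].

Lemma size_act_seq g x : size x = size g -> size (act_seq g x) = size g.
Proof. by move=> e; rewrite size_map size_zip e minnn. Qed.

Lemma delete_act_seq j g x :
  delete j (act_seq g x) = act_seq (delete j g) (delete j x).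
Proof. by rewrite /act_seq delete_map delete_zip. Qed.

Lemma act_seqM k g x : act_seq (translate k g) x = translate k (act_seq g x).
Proof.
rewrite /act_seq /translate; elim: g x => [|a g IH] [|y x] //=.
by rewrite actM IH.
Qed.

Definition average2 (H : seq G -> seq G -> cdual W) g : cdual W :=
  dual_mean (P (size g)) (fun x => H g (act_seq g x)).

Lemma eq_dual_mean m (F F' : seq X -> cdual W) :
  bounded_family F -> bounded_family F' ->
  (forall s, size s = m -> F s = F' s) -> dual_mean (P m) F = dual_mean (P m) F'.
Proof.
move=> bF bF' FF'; apply: cdual_ext => w; rewrite !dual_meanE//.
by apply: P_size => s sm; rewrite FF'.
Qed.

Lemma coboundary2_bounded (H : seq G -> seq G -> cdual W) g :
  (forall g', bounded_family (H g')) -> bounded_family (coboundary2 H g).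
Proof.
move=> bH; have bj (j : 'I_(size g)) :
    exists M : R, forall b, `|H (delete j g) b| <= M by exact: bH.
have [M hM] := choice bj; exists (\sum_j M j) => x.
rewrite (le_trans (ler_norm_sum _ _ _))// ler_sum// => j _.
by rewrite normrZ normrX normrN1 expr1n mul1r.
Qed.

(** By [P_delete], the average over lists shorter by one is an average over full lists with an entry
    deleted, and [g] loses the same entry. *)
Lemma coboundary_average2 (H : seq G -> seq G -> cdual W) g :
  (forall g', bounded_family (H g')) ->
  coboundary (average2 H) g =
  dual_mean (P (size g)) (fun x => coboundary2 H g (act_seq g x)).
Proof.
move=> bH.
have bH2 : bounded_family (fun x => coboundary2 H g (act_seq g x)).
  by have [M h] := coboundary2_bounded g bH; exists M => x.
have bHd g' : bounded_family (fun x => H g' (act_seq g' x)).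
  by have [M h] := bH g'; exists M => x.
have bsgn (j : nat) (f : seq X -> R) : bounded_real f ->
    bounded_real (fun s => (-1) ^+ j * f s).
  by move=> bf; apply: bounded_realM => //; exact: bounded_real_cst.
apply: cdual_ext => w; rewrite dual_meanE// cdual_sumE.
under [X in P _ X]eq_fun do rewrite cdual_sumE.
rewrite mean_sum; last first.
  move=> j; apply: (bsgn j (fun s => H (delete j g) (delete j (act_seq g s)) w)).
  apply: (bounded_real_comp (fun s => delete j (act_seq g s))
    (f := fun b => H (delete j g) b w)).
  exact: bounded_family_eval.
apply: eq_bigr => j _.
rewrite -[LHS]/((-1) ^+ j * average2 H (delete j g) w) dual_meanE//.
rewrite size_delete//.
have g1 : (0 < size g)%N by apply: leq_ltn_trans (ltn_ord j).
rewrite -(P_delete (j := j)); last first.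
- by rewrite -ltnS prednK.
- exact: bounded_family_eval.
rewrite prednK//.
rewrite -meanZ; last first.
  apply: (bounded_real_comp (delete j)
    (f := fun s => H (delete j g) (act_seq (delete j g) s) w)).
  exact: bounded_family_eval.
congr (mean_fun _); apply/funext => s.
by rewrite -[RHS]/((-1) ^+ j * H (delete j g) (delete j (act_seq g s)) w) delete_act_seq.
Qed.

Definition average f := average2 (fun _ => f).

(** Averaging commutes with [rho] and with [coboundary], and does not increase a bound on the norm;
    so neither constant deteriorates. *)
Lemma average_near f M e : near_cocycle f M e -> near_cocycle (average f) M e.
Proof.
move=> [bf ef cf].
have M0 : 0 <= M by rewrite (le_trans _ (bf [::])).
have e0 : 0 <= e by rewrite (le_trans _ (cf [::])).
split => [g|k g|g].
- exact: dual_mean_norm.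
- rewrite /average /average2 -dual_mean_rho; last by exists M.
  rewrite size_translate; apply: dual_mean_dist => //.
  + by exists M => x; rewrite rho_norm.
  + by exists M.
  + by move=> x; rewrite act_seqM.
- rewrite coboundary_average2; last by move=> _; exists M.
  rewrite (@eq_dual_mean _ _ (fun x => coboundary f (act_seq g x))).
  + exact: dual_mean_norm.
  + exists ((size g)%:R * M) => x.
    rewrite (le_trans (ler_norm_sum _ _ _))//.
    rewrite (@le_trans _ _ (\sum_(j < size g) M))//.
      by apply: ler_sum => j _; rewrite normrZ normrX normrN1 expr1n mul1r.
    by rewrite sumr_const card_ord mulr_natl.
  + by exists e.
  + by move=> s ss; rewrite coboundary2r// size_act_seq.
Qed.

(** The homotopy is the average of the prisms between [g] and its random translates. The factor
    [size g] is the number of terms of a prism. *)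
Lemma average_homotopy f M e : near_cocycle f M e ->
  exists h : seq G -> cdual W,
  [/\ forall g, `|h g| <= (size g)%:R * M,
      forall k g, `|rho k (h g) - h (translate k g)| <= (size g)%:R * e &
      forall g, `|average f g - f g - coboundary h g| <= (size g)%:R * e].
Proof.
move=> [bf ef cf].
have M0 : 0 <= M by rewrite (le_trans _ (bf [::])).
have e0 : 0 <= e by rewrite (le_trans _ (cf [::])).
have bp g : bounded_family (prism f g).
  by exists ((size g)%:R * M) => b; exact: prism_norm.
exists (average2 (prism f)); split => [g|k g|g].
- by apply: dual_mean_norm => [|x]; rewrite ?mulr_ge0//; exact: prism_norm.
- rewrite /average2 -dual_mean_rho; last first.
    by have [N hN] := bp g; exists N => x.
  rewrite size_translate; apply: dual_mean_dist.
  + by rewrite mulr_ge0.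
  + by have [N hN] := bp g; exists N => x; rewrite rho_norm.
  + by have [N hN] := bp (translate k g); exists N => x.
  + move=> x; rewrite act_seqM prism_map -prism_rho -prismB.
    exact: prism_norm.
- rewrite coboundary_average2// /average /average2.
  rewrite -[f g](dual_mean_cst (P (size g))).
  rewrite -dual_meanB; [|by exists M|by exists `|f g|].
  have bPc : bounded_family (fun x => prism (coboundary f) g (act_seq g x)).
    by exists ((size g)%:R * e) => x; exact: prism_norm.
  have bF : bounded_family (fun x => f (act_seq g x) - f g).
    by apply: bounded_familyB; [exists M|exists `|f g|].
  rewrite [X in _ - X](@eq_dual_mean _ _ (fun x => (f (act_seq g x) - f g) -
     prism (coboundary f) g (act_seq g x))); last first.
  + move=> s sg; rewrite -prism_homotopy; last by rewrite size_act_seq.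
    by rewrite addrK.
  + by apply: bounded_familyB.
  + by have [N hN] := coboundary2_bounded g bp; exists N => x.
  + apply: dual_mean_dist => [||//|x]; first by rewrite mulr_ge0.
    * exact: bF.
    * exact: bounded_familyB.
    * by rewrite opprB addrC subrK prism_norm.
Qed.

End Averaging.

(** * A law of large numbers *)

Section LawOfLargeNumbers.
Variables (R : realType) (X : Type) (P : mean R X) (k : nat).
Variables (I : 'I_k -> X -> R) (t : 'I_k -> X -> X) (q : R).
Hypothesis q01 : 0 <= q <= 1.
Hypothesis I01 : forall i x, 0 <= I i x <= 1.
Hypothesis condP : forall i (f : X -> R), bounded_real f ->
  P (fun x => I i x * f x) = q * P (fun x => f (t i x)).
Hypothesis It : forall i x, I i (t i x) = 1.
Hypothesis Itn : forall i j x, i != j -> I j (t i x) = I j x.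

(** Here [I i] is the indicator of an event of probability [q], and [t i] plants this event: by
    [condP], composing with [t i] gives the conditional expectation. [S c] is a weighted sum of
    centred indicators. *)
Let S (c : 'I_k -> R) x := \sum_i c i * (I i x - q).

Lemma bounded_indicator i : bounded_real (I i).
Proof.
by exists 1 => x; have /andP[h0 h1] := I01 i x; rewrite ger0_norm.
Qed.

Lemma bounded_deviation c : bounded_real (S c).
Proof.
apply: bounded_real_sum => i; apply: bounded_realM.
  exact: bounded_real_cst.
apply: bounded_realD; [exact: bounded_indicator|exact: bounded_real_cst].
Qed.

(** By [condP], the covariance of [I i] with [f] is [q] times the change that planting makes in the
    mean of [f]. *)
Lemma mean_deviation c (f : X -> R) : bounded_real f ->
  P (fun x => S c x * f x) =
  q * \sum_i c i * (P (fun x => f (t i x)) - P f).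
Proof.
move=> bf.
have bI i : bounded_real (fun x => I i x * f x).
  by apply: bounded_realM => //; exact: bounded_indicator.
have bq : bounded_real (fun x => - (q * f x)).
  by apply/bounded_realN/bounded_realM => //; exact: bounded_real_cst.
transitivity (P (fun x => \sum_i c i * (I i x * f x - q * f x))).
  congr (mean_fun P); apply/funext => x; rewrite mulr_suml.
  by apply: eq_bigr => i _; rewrite -mulrA mulrBl.
rewrite mean_sum; last first.
  move=> i; apply: bounded_realM; first exact: bounded_real_cst.
  exact: bounded_realD.
rewrite mulr_sumr; apply: eq_bigr => i _.
rewrite meanZ; last exact: bounded_realD.
rewrite meanD// meanN; last by apply: bounded_realM => //; exact: bounded_real_cst.
by rewrite condP// (meanZ P q bf) -mulrBr mulrCA.
Qed.

Lemma deviation_planted c i x : S c (t i x) - S c x = c i * (1 - I i x).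
Proof.
rewrite /S -sumrB (bigD1 i)//= big1 => [|j ji].
  by rewrite addr0 It; ring.
by rewrite Itn ?subrr// eq_sym.
Qed.

Lemma variance_deviation c : (forall i, `|c i| <= 1) ->
  P (fun x => S c x * S c x) <= k%:R.
Proof.
move=> c1; have bS := bounded_deviation c; have /andP[q0 q1] := q01.
rewrite mean_deviation// (@le_trans _ _ (q * k%:R))//; last first.
  by rewrite -[leRHS]mul1r ler_wpM2r.
rewrite ler_wpM2l// (@le_trans _ _ (\sum_(i < k) 1))//; last first.
  by rewrite sumr_const card_ord.
apply: ler_sum => i _; rewrite -meanB//; last exact: bounded_real_comp.
rewrite (le_trans (ler_norm _))// normrM mulr_ile1//.
apply: mean_norm_le => x; rewrite deviation_planted normrM mulr_ile1//.
have /andP[h0 h1] := I01 i x.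
by rewrite ger0_norm ?subr_ge0// gerBl.
Qed.

(* The variance of [S] is computed by [condP] as well: planting the i-th pattern
   changes [S] by at most 1, whence [P (S^2) <= k]. *)
Lemma planting_average_bound (f : X -> R) (M e : R) : (forall x, `|f x| <= M) ->
  0 < e ->
  q * \sum_i `|P (fun x => f (t i x)) - P f| <= M * (e * e + k%:R) / (2 * e).
Proof.
move=> fM e0; have bf : bounded_real f by exists M.
(* These signs turn the sum of absolute values into one mean, that of [S c] against [f]. *)
pose c i : R := Num.sg (P (fun x => f (t i x)) - P f).
have -> : q * \sum_i `|P (fun x => f (t i x)) - P f| = P (fun x => S c x * f x).
  rewrite mean_deviation//; congr (_ * _); apply: eq_bigr => i _.
  by rewrite [LHS]normrEsg.
have bS := bounded_deviation c.
have bSS : bounded_real (fun x => S c x * S c x) by exact: bounded_realM.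
have c1 i : `|c i| <= 1 by rewrite /c normr_sg lern1 leq_b1.
pose A := M / (2 * e).
rewrite (@le_trans _ _ (P (fun x => A * (S c x * S c x) + A * (e * e))))//.
  apply: mean_le => [||x]; first exact: bounded_realM.
    apply: bounded_realD; last exact: bounded_real_cst.
    by apply: bounded_realM => //; exact: bounded_real_cst.
  have fx := fM x; have Mx : 0 <= M by rewrite (le_trans _ fx).
  rewrite (le_trans (ler_norm _))// normrM.
  (* AM-GM: [2 e |S| <= S^2 + e^2] *)
  rewrite (@le_trans _ _ (`|S c x| * M))//; first by rewrite ler_wpM2l.
  have -> : S c x * S c x = `|S c x| * `|S c x| by rewrite -!expr2 real_normK ?num_real.
  move: `|S c x| => s; rewrite /A -mulrDr mulrAC ler_pdivlMr ?mulr_gt0//.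
  have -> : M * (s * s + e * e) = s * M * (2 * e) + M * ((s - e) * (s - e)) by ring.
  by rewrite lerDl mulr_ge0// -expr2 sqr_ge0.
rewrite mean_linear//; last exact: bounded_real_cst.
rewrite mean_cst -mulrDr /A [leRHS]mulrAC ler_wpM2l//; last first.
  by rewrite addrC lerD2l variance_deviation.
rewrite divr_ge0 ?mulr_ge0 ?(ltW e0)//.
exact: le_trans (mean_norm_le P fM).
Qed.

End LawOfLargeNumbers.

(** * Random lamp configurations *)

Section RandomLamps.
Variables (R : realType) (Gamma Lambda : groupType).
Local Notation lampsT := {fsfun Lambda -> Gamma with 1%g}.
Implicit Types (x u : lampsT) (l s : Lambda) (A B : seq Lambda) (e : Gamma).

Definition set_lamp l e x : lampsT := [fsfun x with l |-> e].

Lemma set_lampE l e x z : set_lamp l e x z = if z == l then e else x z.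
Proof. exact: fsfun_withE. Qed.

Fixpoint plant A u x : lampsT :=
  if A is l :: A' then set_lamp l (u l) (plant A' u x) else x.

Lemma plantE A u x z : plant A u x z = if z \in A then u z else x z.
Proof.
elim: A => //= l A IH; rewrite set_lampE inE.
by case: eqP => [->|].
Qed.

Definition agree A u x : bool := all (fun l => x l == u l) A.

Lemma agree_plant A u x : agree A u (plant A u x).
Proof. by apply/allP => l lA; rewrite plantE lA. Qed.

Lemma agree_plant_disjoint A u A' u' x : ~~ has (mem A) A' ->
  agree A' u' (plant A u x) = agree A' u' x.
Proof.
move=> /hasPn h; apply: eq_in_all => l /h /=.
by rewrite plantE => /negPf ->.
Qed.

Lemma shift_plant s A u x :
  shift_lamps s (plant A u x) =
  plant (map (fun l => s * l)%g A) (shift_lamps s u) (shift_lamps s x).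
Proof.
apply/fsfunP => z; rewrite shift_lampsE !plantE !shift_lampsE.
by rewrite -{4}(mulVKg s z) (mem_map (mulgI s)).
Qed.

Lemma shift_set_lamp s l e x :
  shift_lamps s (set_lamp l e x) = set_lamp (s * l)%g e (shift_lamps s x).
Proof.
apply/fsfunP => z; rewrite shift_lampsE !set_lampE shift_lampsE.
by rewrite -{3}(mulVKg s z) (inj_eq (mulgI s)).
Qed.

Lemma set_lamp_set l e e' x : set_lamp l e (set_lamp l e' x) = set_lamp l e x.
Proof. by apply/fsfunP => z; rewrite !set_lampE; case: eqP. Qed.

Lemma set_lampC l l' e e' x : l != l' ->
  set_lamp l e (set_lamp l' e' x) = set_lamp l' e' (set_lamp l e x).
Proof.
move=> ll'; apply/fsfunP => z; rewrite !set_lampE.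
by have [->|//] := eqVneq z l; rewrite (negPf ll').
Qed.

(* The law of independent lamps on the sites of [B], uniform on [1 :: E].
   Iterated averages dispense with finite product spaces. *)
Fixpoint finite_lamps (E : seq Gamma) B : mean R lampsT :=
  if B is l :: B' then
    mean_bind (mean_uniform R 1%g E)
      (fun e => mean_push (set_lamp l e) (finite_lamps E B'))
  else mean_dirac R [fsfun of _ => 1%g].

Lemma finite_lamps_cons E l B f : finite_lamps E (l :: B) f =
  mean_uniform R 1%g E (fun e => finite_lamps E B (fun x => f (set_lamp l e x))).
Proof. by []. Qed.

Lemma finite_lamps_shift E s B f :
  finite_lamps E (map (fun l => s * l)%g B) f =
  finite_lamps E B (fun x => f (shift_lamps s x)).
Proof.
elim: B f => [|l B IH] f.
  rewrite /=; congr f; apply/fsfunP => z.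
  by rewrite shift_lampsE !fsfun0E.
rewrite map_cons !finite_lamps_cons; congr (mean_fun _); apply/funext => e.
rewrite IH; congr (mean_fun _); apply/funext => x.
by rewrite shift_set_lamp.
Qed.

(** Independence: conditioning on a lamp amounts to setting it. Induction reaches the first
    occurrence of [l] in [B], which overwrites the later ones; distinct values make the probability
    of [e] exactly the inverse of [(size E).+1]. *)
Lemma finite_lamps_cond E l e B f : uniq (1%g :: E) -> e \in 1%g :: E ->
  l \in B -> bounded_real f ->
  finite_lamps E B (fun x => (x l == e)%:R * f x) =
  (size E).+1%:R^-1 * finite_lamps E B (fun x => f (set_lamp l e x)).
Proof.
move=> uE eE; elim: B f => // l' B IH f; rewrite inE => lB bf; move: lB.
rewrite !finite_lamps_cons; have [<-{l'} _|ll' lB] := eqVneq l l'.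
  transitivity (mean_uniform R 1%g E (fun e' => (e' == e)%:R *
      finite_lamps E B (fun x => f (set_lamp l e x)))).
    congr (mean_fun _); apply/funext => e'.
    have [->|/negPf e'e] := eqVneq e' e.
      rewrite mul1r; congr (mean_fun _); apply/funext => x.
      by rewrite set_lampE !eqxx mul1r.
    rewrite mul0r -[RHS](mean0 (finite_lamps E B)).
    by congr (mean_fun _); apply/funext => x; rewrite set_lampE eqxx e'e mul0r.
  have -> : (fun e' => finite_lamps E B
      (fun x => f (set_lamp l e (set_lamp l e' x)))) =
      (fun=> finite_lamps E B (fun x => f (set_lamp l e x))).
    apply/funext => e'; congr (mean_fun _); apply/funext => x.
    by rewrite set_lamp_set.
  rewrite mean_cst /= /uniform_fun -mulr_suml (bigD1_seq e)//= eqxx.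
  rewrite big1 => [|e' /negPf->//]; first by rewrite addr0 mul1r mulrC.
rewrite -(meanZ (mean_uniform R 1%g E)); last first.
  have [M fM] := bf; exists M => e'; apply: mean_norm_le => x.
  exact: fM.
congr (mean_fun _); apply/funext => e'.
have := IH _ lB (bounded_real_comp (set_lamp l' e') bf).
have -> : (fun x => f (set_lamp l' e' (set_lamp l e x))) =
    (fun x => f (set_lamp l e (set_lamp l' e' x))).
  by apply/funext => x; rewrite set_lampC// eq_sym.
move=> <-; congr (mean_fun _); apply/funext => x.
by rewrite set_lampE (negPf ll').
Qed.

End RandomLamps.

(* The mean of the translates of a limit along finite sets: invariant, and
   concentrated on the sets containing any given finite set. *)
Lemma amenable_set_mean (R : realType) (Lambda : groupType) : amenable R Lambda ->
  exists L : mean R (seq Lambda),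
  (forall s (f : seq Lambda -> R), bounded_real f ->
     L (fun B => f (map (fun l => s * l)%g B)) = L f) /\
  (forall (A : seq Lambda) (f f' : seq Lambda -> R), bounded_real f -> bounded_real f' ->
     (forall B, {subset A <= B} -> f B = f' B) -> L f = L f').
Proof.
move=> /amenable_mean[m minv].
have [||A B|L hL] := @directed_mean R (seq Lambda)
  (fun A B => {subset A <= B}) _ _ _ [::].
- by move=> A x.
- by move=> A B C AB BC x /AB/BC.
- by exists (A ++ B) => x xA; rewrite mem_cat xA ?orbT.
exists (mean_bind m (fun t => mean_push (map (fun l => t * l)%g) L)).
split=> [s f bf|A f f' bf bf' ff'].
  rewrite -[RHS](minv s); last by apply: bind_bounded.
  congr (mean_fun m); apply/funext => t; congr (mean_fun L); apply/funext => B.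
  by congr f; rewrite /= -map_comp; apply: eq_map => l /=; rewrite mulgA.
congr (mean_fun m); apply/funext => t.
pose d B := f (map (fun l => t * l)%g B) - f' (map (fun l => t * l)%g B).
have bd : bounded_real d.
  by apply: bounded_realD; [|apply: bounded_realN]; exact: bounded_real_comp.
(* The translate of [B] by [t] contains [A] once [B] contains the translate of [A] by [t^-1], which
   holds eventually along [L]. *)
have d0 B : {subset map (fun l => t^-1 * l)%g A <= B} -> d B = 0.
  move=> AB; apply/eqP; rewrite subr_eq0; apply/eqP/ff' => l lA.
  apply/mapP; exists (t^-1 * l)%g; last by rewrite mulVKg.
  by apply: AB; apply: map_f.
have : L d = 0.
  apply/eqP; rewrite eq_le; apply/andP; split.
    by apply: (hL (map (fun l => t^-1 * l)%g A)) => // B /d0 ->.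
  rewrite -oppr_le0 -meanN//.
  apply: (hL (map (fun l => t^-1 * l)%g A)) => [|B /d0 ->].
    exact: bounded_realN.
  by rewrite oppr0.
rewrite meanB; try exact: bounded_real_comp.
by move=> /eqP; rewrite subr_eq0 => /eqP.
Qed.

Section InfiniteRandomLamps.
Variables (R : realType) (Gamma Lambda : groupType).
Local Notation lampsT := {fsfun Lambda -> Gamma with 1%g}.
Implicit Types (A : seq Lambda) (u : lampsT) (l s : Lambda).
Variable L : mean R (seq Lambda).
Hypothesis L_shift : forall s (f : seq Lambda -> R), bounded_real f ->
  L (fun B => f (map (fun l => s * l)%g B)) = L f.
Hypothesis L_large : forall (A : seq Lambda) (f f' : seq Lambda -> R),
  bounded_real f -> bounded_real f' ->
  (forall B, {subset A <= B} -> f B = f' B) -> L f = L f'.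
Variable E : seq Gamma.
Hypothesis uniqE : uniq (1%g :: E).

(** A shift-invariant substitute for independent lamps at all sites, which would not have finite
    support: by [L_large] any given finite set of sites counts as contained in the random set
    [B]. *)
Definition lamp_mean : mean R lampsT := mean_bind L (finite_lamps R (Lambda:=_) E).

Lemma lamp_mean_shift s (f : lampsT -> R) : bounded_real f ->
  lamp_mean (fun x => f (shift_lamps s x)) = lamp_mean f.
Proof.
move=> bf; rewrite -[RHS](L_shift s); last exact: bind_bounded.
by congr (mean_fun L); apply/funext => B; rewrite finite_lamps_shift.
Qed.

Let q : R := (size E).+1%:R^-1.

Lemma lamp_mean_cond1 l e (f : lampsT -> R) : e \in 1%g :: E -> bounded_real f ->
  lamp_mean (fun x => (x l == e)%:R * f x) =
  q * lamp_mean (fun x => f (set_lamp l e x)).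
Proof.
move=> eE bf.
have bind_bd (h : lampsT -> R) : bounded_real h ->
    bounded_real (fun B => finite_lamps R E B h) by move=> ?; exact: bind_bounded.
have bi : bounded_real (fun x : lampsT => (x l == e)%:R * f x).
  apply: bounded_realM => //; exists 1 => x.
  by rewrite ger0_norm ?ler0n// lern1 leq_b1.
have bs : bounded_real (fun x => f (set_lamp l e x)) by exact: bounded_real_comp.
have bb := bind_bd _ bs.
transitivity (L (fun B => q * finite_lamps R E B (fun x => f (set_lamp l e x))));
  last exact: meanZ.
(* Only the sets containing [l] matter, and for them conditioning is known. *)
apply: (@L_large [:: l]).
- exact: bind_bd.
- by apply: bounded_realM => //; exact: bounded_real_cst.
- by move=> B lB; apply: finite_lamps_cond => //; apply: lB; rewrite inE.
Qed.

(** One site at a time: as the sites are distinct, setting a lamp does not affect agreement at the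
    remaining ones. *)
Lemma lamp_mean_cond A u (f : lampsT -> R) : uniq A ->
  (forall l, l \in A -> u l \in 1%g :: E) -> bounded_real f ->
  lamp_mean (fun x => (agree A u x)%:R * f x) =
  q ^+ size A * lamp_mean (fun x => f (plant A u x)).
Proof.
elim: A f => [|l A IH] f /=.
  move=> _ _ bf; rewrite expr0 mul1r; congr (mean_fun lamp_mean); apply/funext => x.
  by rewrite mul1r.
move=> /andP[lA uA] uE bf.
have buE : forall l', l' \in A -> u l' \in 1%g :: E.
  by move=> l' l'A; apply: uE; rewrite inE l'A orbT.
have bi : bounded_real (fun x : lampsT => (agree A u x)%:R * f x).
  apply: bounded_realM => //; exists 1 => x.
  by rewrite ger0_norm ?ler0n// lern1 leq_b1.
transitivity (lamp_mean (fun x => (x l == u l)%:R * ((agree A u x)%:R * f x))).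
  by congr (mean_fun lamp_mean); apply/funext => x; rewrite mulrA -natrM mulnb.
rewrite lamp_mean_cond1//; last by apply: uE; rewrite inE eqxx.
rewrite exprS -mulrA.
have <- := IH (fun y => f (set_lamp l (u l) y)) uA buE (bounded_real_comp _ bf).
congr (_ * _); congr (mean_fun lamp_mean); apply/funext => x; congr (_%:R * _).
congr nat_of_bool; apply: eq_in_all => l' l'A; rewrite set_lampE.
by have [e|//] := eqVneq l' l; rewrite -e l'A in lA.
Qed.

Implicit Types (pl : seq (seq Lambda * lampsT)) (xs : seq lampsT).

Definition agrees pl xs : bool :=
  all (fun q => agree q.1.1 q.1.2 q.2) (zip pl xs).

Definition plants pl xs : seq lampsT :=
  [seq plant q.1.1 q.1.2 q.2 | q <- zip pl xs].

(** Such patterns have as probability a power of the single-lamp probability: no site is counted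
    twice, and the prescribed values are all possible. *)
Definition admissible pl := forall q, q \in pl ->
  uniq q.1 /\ forall l, l \in q.1 -> q.2 l \in 1%g :: E.

Lemma product_lamp_mean_cond pl (f : seq lampsT -> R) : admissible pl ->
  bounded_real f ->
  product_mean lamp_mean (size pl) (fun xs => (agrees pl xs)%:R * f xs) =
  q ^+ (\sum_(a <- pl) size a.1) *
  product_mean lamp_mean (size pl) (fun xs => f (plants pl xs)).
Proof.
elim: pl f => [|[A u] pl IH] f adm bf.
  by rewrite big_nil expr0 mul1r /= mul1r.
have [uA uE] := adm (A, u) (mem_head _ _).
have adm' : admissible pl by move=> a apl; apply: adm; rewrite inE apl orbT.
have bP x : bounded_real (fun xs => f (x :: xs)) by exact: bounded_real_comp.
rewrite big_cons exprD.
transitivity (lamp_mean (fun x => (agree A u x)%:R *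
   product_mean lamp_mean (size pl) (fun xs => (agrees pl xs)%:R * f (x :: xs)))).
  congr (mean_fun lamp_mean); apply/funext => x; rewrite -meanZ; last first.
    apply: bounded_realM => //; exists 1 => xs.
    by rewrite ger0_norm ?ler0n// lern1 leq_b1.
  by congr (mean_fun (product_mean _ _)); apply/funext => xs; rewrite mulrA -natrM mulnb.
rewrite lamp_mean_cond//; last first.
  have [M fM] := bf; exists M => x; apply: mean_norm_le => xs.
  by rewrite normrM -[M]mul1r ler_pM// ger0_norm ?ler0n// lern1 leq_b1.
rewrite -mulrA; congr (_ * _).
pose F x := product_mean lamp_mean (size pl)
  (fun xs => f (plant A u x :: plants pl xs)).
have bF : bounded_real F.
  by have [M fM] := bf; exists M => x; apply: mean_norm_le => xs.
transitivity (lamp_mean (fun x => q ^+ (\sum_(a <- pl) size a.1) * F x));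
  last by rewrite meanZ.
congr (mean_fun lamp_mean); apply/funext => x.
by apply: (IH (fun xs => f (plant A u x :: xs))) => //; exact: bounded_real_comp.
Qed.

(** Each entry has its own shift, since the entries of a list in the lamplighter group have
    different ones. *)
Lemma product_lamp_mean_shift (ss : seq Lambda) (f : seq lampsT -> R) :
  bounded_real f ->
  product_mean lamp_mean (size ss)
    (fun xs => f [seq shift_lamps q.1 q.2 | q <- zip ss xs]) =
  product_mean lamp_mean (size ss) f.
Proof.
elim: ss f => // s ss IH f bf.
pose F x := product_mean lamp_mean (size ss) (fun xs => f (x :: xs)).
have bF : bounded_real F.
  by have [M fM] := bf; exists M => x; apply: mean_norm_le => xs.
transitivity (lamp_mean (fun x => F (shift_lamps s x)));
  last by rewrite lamp_mean_shift.
congr (mean_fun lamp_mean); apply/funext => x.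
by apply: (IH (fun xs => f (shift_lamps s x :: xs))); exact: bounded_real_comp.
Qed.

Lemma agrees_plants pl xs : agrees pl (plants pl xs).
Proof.
rewrite /agrees /plants; elim: pl xs => [|a pl IH] [|x xs] //=.
by rewrite agree_plant IH.
Qed.

Definition shift_plants s pl :=
  [seq (map (fun l => s * l)%g q.1, shift_lamps s q.2) | q <- pl].

Lemma agrees_plants_disjoint pl s s' xs :
  (forall a l l', a \in pl -> l \in a.1 -> l' \in a.1 -> s * l != s' * l')%g ->
  agrees (shift_plants s' pl) (plants (shift_plants s pl) xs) =
  agrees (shift_plants s' pl) xs.
Proof.
rewrite /agrees /plants; elim: pl xs => [|a pl IH] [|x xs] //= h.
rewrite IH; last by move=> b l l' bpl; apply: h; rewrite inE bpl orbT.
congr (_ && _); apply: agree_plant_disjoint.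
apply/hasPn => _ /mapP[l' l'a ->]; apply/mapP => -[l la /eqP].
by rewrite eq_sym; apply/negP/(h a); rewrite ?mem_head.
Qed.

Lemma shift_plantsE s pl xs : size xs = size pl ->
  plants (shift_plants s pl) (map (shift_lamps s) xs) =
  map (shift_lamps s) (plants pl xs).
Proof.
rewrite /plants /shift_plants.
elim: pl xs => [|a pl IH] [|x xs] //= [sx].
by rewrite IH// shift_plant.
Qed.

Lemma admissible_shift s pl : admissible pl -> admissible (shift_plants s pl).
Proof.
move=> adm _ /mapP[a apl ->] /=; have [ua ea] := adm a apl.
split; first by rewrite map_inj_uniq//; exact: mulgI.
by move=> _ /mapP[l la ->]; rewrite shift_lampsE mulKg; exact: ea.
Qed.

End InfiniteRandomLamps.

(** * Planted patterns *)

Lemma infinite_fresh (T : choiceType) (s : seq T) :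
  infinite_set [set: T] -> exists x, x \notin s.
Proof.
move=> infT; apply: contrapT => h; apply: infT.
apply: (@sub_finite_set _ _ [set` s]); last exact: finite_seq.
by move=> x _ /=; apply: contrapT => /negP xs; apply: h; exists x.
Qed.

Lemma disjoint_translates (Lambda : groupType) (A : seq Lambda) (k : nat) :
  infinite_set [set: Lambda] ->
  exists s : 'I_k -> Lambda, forall i j l l', i != j -> l \in A -> l' \in A ->
    (s i * l != s j * l')%g.
Proof.
move=> infL.
pose sep s t := all (fun l => all (fun l' => s * l != t * l')%g A) A.
have [ss sk ps] : exists2 ss, size ss = k & pairwise sep ss.
  elim: k => [|k [ss sk ps]]; first by exists [::].
  (* The new element avoids the finitely many solutions of [x * l = t * l'] with [t] already chosen
     and [l], [l'] in [A]. *)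
  have [x xn] := infinite_fresh
    [seq (q.1 * (q.2.1 / q.2.2))%g | q <- allpairs pair ss (allpairs pair A A)] infL.
  exists (x :: ss); rewrite /= ?sk// ps andbT.
  apply/allP => t tss; apply/allP => l lA; apply/allP => l' l'A.
  apply: contra xn => /eqP e; apply/mapP; exists (t, (l', l)) => /=.
    by rewrite allpairs_f// allpairs_f.
  by rewrite mulgA -e mulgK.
have sepP i j : (i < j < k)%N -> sep (nth 1%g ss i) (nth 1%g ss j).
  move=> /andP[ij jk]; apply: (pairwiseP 1%g ps) => //; rewrite inE sk//.
  exact: ltn_trans jk.
exists (fun i => nth 1%g ss i) => i j l l' ij lA l'A.
have [ltij|ltji|/val_inj eij] := ltngtP i j.
- have /allP/(_ _ lA)/allP/(_ _ l'A) : sep (nth 1%g ss i) (nth 1%g ss j).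
    by apply: sepP; rewrite ltij ltn_ord.
  by [].
- have /allP/(_ _ l'A)/allP/(_ _ lA) : sep (nth 1%g ss j) (nth 1%g ss i).
    by apply: sepP; rewrite ltji ltn_ord.
  by rewrite eq_sym.
- by rewrite eij eqxx in ij.
Qed.

(** After division by [m * m] the right-hand side is [B / m], which tends to 0. *)
Lemma le_of_square_average (R : realType) (x y B : R) : 0 <= B ->
  (forall m : nat, (0 < m)%N -> (m * m)%:R * (x - y) <= B * m%:R) -> x <= y.
Proof.
move=> B0 h; rewrite leNgt; apply/negP => yx.
have d0 : 0 < x - y by rewrite subr_gt0.
pose m := Num.bound (B / (x - y)).
have hm : B / (x - y) < m%:R.
  by rewrite archi_boundP// divr_ge0// ltW.
have m0 : (0 < m)%N.
  by rewrite -(ltr_nat R) (le_lt_trans _ hm)// divr_ge0// ltW.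
have := h _ m0; rewrite natrM -mulrA mulrC ler_pM2r ?ltr0n//.
by rewrite leNgt -ltr_pdivrMr// hm.
Qed.

Section PlantedLamps.
Variables (R : realType) (W : normedModType R) (Gamma Lambda : groupType).
Local Notation lampsT := {fsfun Lambda -> Gamma with 1%g}.
Variables (r : Lambda -> W -> W) (rho : Lambda -> cdual W -> cdual W).
Hypothesis rhoE : forall s u w, rho s u w = u (r s w).
Hypothesis rho_norm : forall s u, `|rho s u| = `|u|.
Variables (ws : seq W) (K : R).
Hypothesis K0 : 0 <= K.
Hypothesis norm_ws : forall u : cdual W, `|u| <= K * \sum_(w <- ws) `|u w|.
Hypothesis infL : infinite_set [set: Lambda].
Variable L : mean R (seq Lambda).
Hypothesis L_shift : forall s (f : seq Lambda -> R), bounded_real f ->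
  L (fun B => f (map (fun l => s * l)%g B)) = L f.
Hypothesis L_large : forall (A : seq Lambda) (f f' : seq Lambda -> R),
  bounded_real f -> bounded_real f' ->
  (forall B, {subset A <= B} -> f B = f' B) -> L f = L f'.
Variable E : seq Gamma.
Hypothesis uniqE : uniq (1%g :: E).
Variables (phi : seq lampsT -> cdual W) (M e : R).
Hypothesis phi_bounded : forall xs, `|phi xs| <= M.
Hypothesis phi_shift : forall s xs,
  `|rho s (phi xs) - phi (map (shift_lamps s) xs)| <= e.

Let P (m : nat) := product_mean (lamp_mean L E) m.

Let e0 : 0 <= e.
Proof. exact: le_trans (normr_ge0 _) (phi_shift 1%g [::]). Qed.

Let bphi (X : Type) (h : X -> seq lampsT) : bounded_family (fun x => phi (h x)).
Proof. by exists M. Qed.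

(** For admissible [pl] this is, by [product_lamp_mean_cond], the expectation of [phi] conditioned
    on the patterns of [pl]. *)
Definition planted_mean (pl : seq (seq Lambda * lampsT)) : cdual W :=
  dual_mean (P (size pl)) (fun xs => phi (plants pl xs)).

Lemma dual_mean_shift m s (F : seq lampsT -> cdual W) : bounded_family F ->
  dual_mean (P m) (fun xs => F (map (shift_lamps s) xs)) = dual_mean (P m) F.
Proof.
move=> bF; have bFs : bounded_family (fun xs => F (map (shift_lamps s) xs)).
  by have [N h] := bF; exists N => x.
apply: cdual_ext => w; rewrite !dual_meanE//.
have := product_lamp_mean_shift L_shift E (nseq m s) (bounded_family_eval w bF).
rewrite size_nseq => <-.
apply: eq_product_mean => xs sxs; congr (F _ w).
rewrite -sxs.
by elim: xs {sxs} => //= x xs ->.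
Qed.

(** The law of the lamps is shift-invariant, so only the defect of equivariance of [phi]
    contributes. *)
Lemma mean_near_invariant m s :
  `|rho s (dual_mean (P m) phi) - dual_mean (P m) phi| <= e.
Proof.
rewrite -(dual_mean_rho rhoE rho_norm); last exact: (bphi id).
rewrite -[X in _ - X](dual_mean_shift m s); last exact: (bphi id).
apply: dual_mean_dist => //.
by exists M => xs; rewrite rho_norm.
Qed.

Lemma planted_mean_shift s pl :
  `|rho s (planted_mean pl) - planted_mean (shift_plants s pl)| <= e.
Proof.
rewrite /planted_mean -(dual_mean_rho rhoE rho_norm); last exact: bphi.
rewrite {2}/shift_plants size_map.
rewrite -[X in _ - X](dual_mean_shift (size pl) s); last exact: bphi.
have -> : dual_mean (P (size pl))
    (fun xs => phi (plants (shift_plants s pl) (map (shift_lamps s) xs))) =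
  dual_mean (P (size pl)) (fun xs => phi (map (shift_lamps s) (plants pl xs))).
  apply: cdual_ext => w.
  rewrite (dual_meanE _ _ (bphi (fun xs => plants _ (map (shift_lamps s) xs)))).
  rewrite (dual_meanE _ _ (bphi _)).
  by apply: eq_product_mean => xs sxs; rewrite shift_plantsE.
apply: dual_mean_dist => //.
by exists M => xs; rewrite rho_norm.
Qed.

(* By [planted_mean_shift] and [mean_near_invariant], the distance to [C] is
   nearly the same for all translates of [pl]; along [m * m] disjoint ones the
   law of large numbers makes the sum of these distances O(m). *)
Lemma planted_mean_near pl : admissible E pl ->
  `|planted_mean pl - dual_mean (P (size pl)) phi| <= 2 * e.
Proof.
move=> adm; set C := dual_mean _ _.
pose q : R := (size E).+1%:R^-1 ^+ (\sum_(a <- pl) size a.1).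
have q0 : 0 < q by rewrite exprn_gt0// invr_gt0 ltr0n.
have q1 : q <= 1.
  by rewrite exprn_ile1// ?invr_ge0 ?ler0n// invf_le1 ?ltr0n// ler1n.
have M0 : 0 <= M by exact: le_trans (normr_ge0 _) (phi_bounded [::]).
(* [B] depends on the patterns through [q], and on the norming vectors, but it disappears from the
   conclusion as [m] grows. *)
pose B := K * (\sum_(w <- ws) (M * `|w|) / q).
have B0 : 0 <= B.
  by rewrite mulr_ge0// sumr_ge0// => w _; rewrite divr_ge0 ?mulr_ge0// ltW.
apply: (le_of_square_average B0) => m m0.
have [s hs] := disjoint_translates (flatten [seq a.1 | a <- pl]) (m * m) infL.
have in_flat a l : a \in pl -> l \in a.1 -> l \in flatten [seq a.1 | a <- pl].
  by move=> apl la; apply/flattenP; exists a.1 => //; exact: map_f.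
pose t i := plants (shift_plants (s i) pl).
have lln w : \sum_i `|(planted_mean (shift_plants (s i) pl) - C) w|
    <= (M * `|w|) / q * m%:R.
  have mR0 : 0 < m%:R :> R by rewrite ltr0n.
  rewrite mulrAC ler_pdivlMr// mulrC.
  pose I i (xs : seq lampsT) : R := (agrees (shift_plants (s i) pl) xs)%:R.
  have := @planting_average_bound R _ (P (size pl)) (m * m) I t q.
  move=> /(_ _ _ _ _ _ (fun xs => phi xs w) (M * `|w|) m%:R) h.
  have -> : \sum_i `|(planted_mean (shift_plants (s i) pl) - C) w| =
     \sum_i `|P (size pl) (fun xs => phi (t i xs) w) -
              P (size pl) (fun xs => phi xs w)|.
    apply: eq_bigr => i _; rewrite cdualBE /C.
    rewrite (dual_meanE _ _ (bphi id)) /planted_mean (dual_meanE _ _ (bphi _)).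
    by rewrite size_map.
  (* The parameter [m], the square root of the number of translates, makes both terms of the
     numerator equal. *)
  have -> : M * `|w| * m%:R = M * `|w| * (m%:R * m%:R + (m * m)%:R) / (2 * m%:R).
    by rewrite natrM; field; rewrite gt_eqF.
  apply: h => //.
  - by rewrite (ltW q0).
  - by move=> i xs; rewrite ler0n lern1 leq_b1.
  - move=> i f bf; rewrite /I.
    have := product_lamp_mean_cond L_large uniqE (admissible_shift (s := s i) adm) bf.
    rewrite size_map => ->; congr (_ ^+ _ * _).
    by rewrite big_map; apply: eq_bigr => a _; rewrite size_map.
  - by move=> i xs; rewrite /I agrees_plants.
  - move=> i j xs ij; rewrite /I /t agrees_plants_disjoint// => a l l' apl la l'a.
    by apply: hs => //; apply: (in_flat a).
  - move=> xs; rewrite (le_trans (cdual_op_norm _ _))// ler_wpM2r//.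
(* One error [e] comes from moving the planted mean, the other from moving [C]. *)
have shiftC i : `|planted_mean pl - C| - 2 * e <=
    `|planted_mean (shift_plants (s i) pl) - C|.
  rewrite lerBlDr -(rho_norm (s i)) (rhoB rhoE).
  set x := rho _ _; set y := rho _ _; set z := planted_mean _.
  have -> : x - y = (z - C) + ((x - z) - (y - C)).
    by rewrite opprB addrA [z - C + _]addrC [x - z + _]addrA subrK addrA subrK.
  rewrite (le_trans (ler_normD _ _))// lerD2l mulrDl mul1r.
  rewrite (le_trans (ler_normB _ _))// lerD//.
    exact: planted_mean_shift.
  exact: mean_near_invariant.
rewrite (@le_trans _ _ (\sum_(i < m * m)
  `|planted_mean (shift_plants (s i) pl) - C|))//.
  have -> : (m * m)%:R * (`|planted_mean pl - C| - 2 * e) =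
     \sum_(i < m * m) (`|planted_mean pl - C| - 2 * e).
    by rewrite sumr_const card_ord mulr_natl.
  by apply: ler_sum => i _.
rewrite (@le_trans _ _ (\sum_(i < m * m) K * \sum_(w <- ws)
  `|(planted_mean (shift_plants (s i) pl) - C) w|))//.
  by apply: ler_sum => i _; exact: norm_ws.
rewrite -mulr_sumr exchange_big /= /B -mulrA ler_wpM2l// mulr_suml.
by apply: ler_sum => w _; exact: lln.
Qed.

End PlantedLamps.

(** * Norming vectors for a finite-dimensional dual *)

Section NormingVectors.
Variables (R : realType) (W : normedModType R).
Implicit Types (u v b : cdual W) (bs : seq (cdual W)).

Fixpoint in_span bs u : Prop :=
  if bs is b :: bs' then exists t : R, in_span bs' (u - t *: b) else u = 0.

(** Elimination: correcting the generators by multiples of [b] corrects [u] by a multiple of [b]. *)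
Lemma in_span_reduce (c : cdual W -> R) b bs u : in_span bs u ->
  exists t : R, in_span [seq b' - c b' *: b | b' <- bs] (u - t *: b).
Proof.
elim: bs u => [|b' bs IH] u /=; first by move=> ->; exists 0; rewrite scale0r subr0.
move=> [t /IH[t' h]]; exists (t * c b' + t'), t.
congr (in_span _ _): h.
rewrite scalerBr scalerA scalerDl !opprD opprK -!addrA; congr (u + _).
by rewrite [- (t *: b') + _ in RHS]addrC (addrCA (- (t' *: b))) addKr addrC.
Qed.

(** Gaussian elimination: pick [w] where [b] does not vanish and reduce the other generators so that
    they vanish at [w]. The coefficient of [b] in [u] is then read off at [w]. *)
Lemma norming_vectors_span bs : exists (ws : seq W) (K : R), 0 <= K /\
  forall u, in_span bs u -> `|u| <= K * \sum_(w <- ws) `|u w|.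
Proof.
have [n] := ubnP (size bs); elim: n bs => // n IH [|b bs] /=.
  by exists [::], 0; split=> // u ->; rewrite normr0 mul0r.
rewrite ltnS => sb.
have [b0|/eqP bn0] := pselect (b = 0).
  have [ws [K [K0 h]]] := IH bs sb; exists ws, K; split=> // u [t].
  by rewrite b0 scaler0 subr0; exact: h.
have [w bw] : exists w, b w != 0.
  apply: contrapT => h; move/eqP: bn0; apply; apply: cdual_ext => w.
  by apply/eqP; apply/negPn/negP => bw; apply: h; exists w.
pose bs' := [seq b' - (b' w / b w) *: b | b' <- bs].
have bs'w v : in_span bs' v -> v w = 0.
  rewrite /bs'; elim: (bs) v => [v ->//|b' cs IHc v /= [t /IHc]].
  rewrite -[X in X = 0 -> _]/(v w - t * (b' w - b' w / b w * b w)).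
  by rewrite divfK// subrr mulr0 subr0.
have [|ws [K [K0 hK]]] := IH bs'; first by rewrite size_map.
(* The second term pays for the summand [t *: b] and for subtracting it inside the inductive bound,
   with [|t|] equal to [|u w| / |b w|]. *)
exists (w :: ws), (K + (`|b| + K * \sum_(x <- ws) `|b x|) / `|b w|).
have Sb : 0 <= \sum_(x <- ws) `|b x| by apply: sumr_ge0.
have nb : 0 <= (`|b| + K * \sum_(x <- ws) `|b x|) / `|b w|.
  by rewrite divr_ge0// addr_ge0// mulr_ge0.
split; first by rewrite addr_ge0.
move=> u [t0 /(in_span_reduce (fun b' => b' w / b w) b)[t1]].
rewrite -/bs' -addrA -opprD -scalerDl; move: (t0 + t1) => t {t0 t1} hv.
have tE : `|t| = `|u w| / `|b w|.
  have /eqP := bs'w _ hv; rewrite -[X in X == _]/(u w - t * b w) subr_eq0 => /eqP ->.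
  by rewrite normrM mulfK// normr_eq0.
have -> : u = (u - t *: b) + t *: b by rewrite subrK.
rewrite (le_trans (ler_normD _ _))// normrZ subrK big_cons.
have Su : 0 <= \sum_(x <- ws) `|u x| by apply: sumr_ge0.
have h1 : `|u - t *: b| <= K * (\sum_(x <- ws) `|u x| + `|t| * \sum_(x <- ws) `|b x|).
  rewrite (le_trans (hK _ hv))// ler_wpM2l// mulr_sumr -big_split/=.
  by apply: ler_sum => x _; rewrite -normrM; exact: ler_normB.
have := lerD h1 (lexx (`|t| * `|b|)); move/le_trans; apply.
rewrite tE; set S := \sum_(x <- ws) `|u x| in Su *.
set Tb := \sum_(x <- ws) `|b x| in Sb nb *.
have -> : (K + (`|b| + K * Tb) / `|b w|) * (`|u w| + S) =
   (K * (S + `|u w| / `|b w| * Tb) + `|u w| / `|b w| * `|b|) +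
   (K * `|u w| + (`|b| + K * Tb) / `|b w| * S).
  by field; rewrite normr_eq0.
by rewrite lerDl addr_ge0// mulr_ge0.
Qed.

Lemma in_span_sum (I : Type) (s : seq I) (a : I -> R) (F : I -> cdual W) :
  in_span (map F s) (\sum_(i <- s) a i *: F i).
Proof.
elim: s => [|i s IH] /=; first by rewrite big_nil.
by exists (a i); rewrite big_cons addrAC subrr add0r.
Qed.

(** The images under [phi] of a basis of [V] span the dual. There is no control on [K], but [K] does
    not enter the bound of [planted_mean_near]. *)
Lemma norming_vectors (V : normedModType R) (phi : V -> cdual W) (k : nat) :
  linear phi -> bijective phi -> Vector.axiom k V ->
  exists (ws : seq W) (K : R), 0 <= K /\
    forall u, `|u| <= K * \sum_(w <- ws) `|u w|.
Proof.
move=> lphi [psi phiK psiK] [v2r lv [r2v v2rK r2vK]].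
pose F j := phi (r2v (delta_mx 0 j)).
have [ws [K [K0 h]]] := norming_vectors_span [seq F j | j <- index_enum 'I_k].
exists ws, K; split=> // u; apply: h.
have lr : linear (phi \o r2v).
  move=> a x y /=; rewrite -lphi; congr phi.
  by apply: (can_inj v2rK); rewrite lv !r2vK.
pose l : {linear 'rV[R]_k -> cdual W} :=
  HB.pack (phi \o r2v) (GRing.isLinear.Build _ _ _ _ _ lr).
have -> : u = l (v2r (psi u)) by rewrite /= v2rK psiK.
rewrite [v2r _]row_sum_delta linear_sum.
under eq_bigr => j _ do rewrite linearZ.
exact: (in_span_sum _ _ F).
Qed.

End NormingVectors.

(** * Averages of lamplighter cochains *)

Section LamplighterCochains.
Variables (R : realType) (W : normedModType R) (Gamma Lambda : groupType).
Local Notation lampsT := {fsfun Lambda -> Gamma with 1%g}.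
Local Notation G := (lamplighter Gamma Lambda).
Local Notation one_lamps := ([fsfun of _ => 1%g] : lampsT).
Implicit Types (g : seq G) (xs : seq lampsT) (s : Lambda) (k : G).

Definition of_lamps (x : lampsT) : G := Lamplighter x 1%g.
Definition of_shift (s : Lambda) : G := Lamplighter one_lamps s.

Lemma lampsM k k' :
  lamps (k * k')%g = mul_lamps (lamps k) (shift_lamps (lamp_shift k) (lamps k')).
Proof. by []. Qed.

Lemma mul_of_shift k s :
  (k * of_shift s)%g = Lamplighter (lamps k) (lamp_shift k * s)%g.
Proof.
case: k => x t; congr Lamplighter; apply/fsfunP => z.
by rewrite mul_lampsE shift_lampsE fsfun0E mulg1.
Qed.

Lemma lamps_shift_mul s x : lamps (of_shift s * of_lamps x)%g = shift_lamps s x.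
Proof. by rewrite lampsM; apply/fsfunP => z; rewrite mul_lampsE fsfun0E mul1g. Qed.

Variables (r : G -> W -> W) (rho : G -> cdual W -> cdual W).
Hypothesis rhoE : forall k u w, rho k u w = u (r k w).
Hypothesis rho_norm : forall k u, `|rho k u| = `|u|.
Implicit Types (f : seq G -> cdual W).

Section RightInvariance.
Variable m : mean R Lambda.
Hypothesis m_inv : forall s (f : Lambda -> R), bounded_real f ->
  m (fun t => f (s * t)%g) = m f.

(** In each entry, left invariance of [m] absorbs the shift of [k], and only its lamps remain. *)
Lemma product_mean_right_invariant g (f : seq G -> R) : bounded_real f ->
  product_mean m (size g)
    (fun ts => f (act_seq (fun k s => (k * of_shift s)%g) g ts)) =
  product_mean m (size g)
    (fun ts => f (act_seq (fun k s => (k * of_shift s)%g)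
                          [seq of_lamps (lamps k) | k <- g] ts)).
Proof.
elim: g f => // k g IH f bf.
pose F t := product_mean m (size g) (fun ts => f (Lamplighter (lamps k) t ::
  act_seq (fun k s => (k * of_shift s)%g) [seq of_lamps (lamps k) | k <- g] ts)).
have bF : bounded_real F.
  by have [M h] := bf; exists M => t; exact: mean_norm_le.
transitivity (m (fun t => F (lamp_shift k * t)%g)).
  congr (mean_fun m); apply/funext => t.
  rewrite /F -(IH (fun l => f (Lamplighter (lamps k) (lamp_shift k * t)%g :: l))).
    congr (mean_fun (product_mean _ _)); apply/funext => ts.
    by rewrite /act_seq /= mul_of_shift.
  exact: (bounded_real_comp (fun l => _ :: l)).
rewrite m_inv//; congr (mean_fun m); apply/funext => t.
congr (mean_fun (product_mean _ _)); apply/funext => ts.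
by rewrite /act_seq /= mul_of_shift /= mul1g.
Qed.

End RightInvariance.

Lemma right_invariant_cochain f M e : amenable R Lambda ->
  near_cocycle rho f M e ->
  exists f' h : seq G -> cdual W,
  [/\ near_cocycle rho f' M e,
      forall g, f' g = f' [seq of_lamps (lamps k) | k <- g],
      forall g, `|h g| <= (size g)%:R * M,
      forall k g, `|rho k (h g) - h (translate k g)| <= (size g)%:R * e &
      forall g, `|f' g - f g - coboundary h g| <= (size g)%:R * e].
Proof.
move=> /amenable_mean[m m_inv] nf.
pose act k s := (k * of_shift s)%g.
have actM k k' s : act (k * k')%g s = (k * act k' s)%g by rewrite /act mulgA.
have Pd n j (h : seq Lambda -> R) : bounded_real h -> (j <= n)%N ->
    product_mean m n.+1 (fun ts => h (delete j ts)) = product_mean m n h.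
  by move=> _; exact: product_mean_delete.
have [h [h1 h2 h3]] := average_homotopy rhoE rho_norm actM
  (@eq_product_mean R _ m) Pd nf.
exists (average act (product_mean m) f), h; split=> //.
  exact: (average_near rhoE rho_norm actM (@eq_product_mean R _ m) Pd).
have [bf _ _] := nf.
have bF (X : Type) (l : X -> seq G) : bounded_family (fun x => f (l x)) by exists M.
move=> g; apply: cdual_ext => w; rewrite /average /average2.
rewrite (dual_meanE _ _ (bF _ (fun x => act_seq act g x))).
rewrite (dual_meanE _ _ (bF _ (fun x => act_seq act _ x))) size_map.
apply: (product_mean_right_invariant m_inv g (f := fun l => f l w)).
exact: bounded_family_eval (bF _ id).
Qed.

End LamplighterCochains.

Arguments of_lamps {Gamma Lambda} x.

(** * The second average, over random lamps *)

Section ConstantAverage.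
Variables (R : realType) (W : normedModType R) (Gamma Lambda : groupType).
Local Notation lampsT := {fsfun Lambda -> Gamma with 1%g}.
Local Notation G := (lamplighter Gamma Lambda).
Local Notation one_lamps := ([fsfun of _ => 1%g] : lampsT).
Implicit Types (g : seq G) (xs : seq lampsT) (s : Lambda) (k : G).
Variables (r : G -> W -> W) (rho : G -> cdual W -> cdual W).
Hypothesis rhoE : forall k u w, rho k u w = u (r k w).
Hypothesis rho_norm : forall k u, `|rho k u| = `|u|.
Implicit Types (f : seq G -> cdual W).
Variables (ws : seq W) (K : R).
Hypothesis K0 : 0 <= K.
Hypothesis norm_ws : forall u : cdual W, `|u| <= K * \sum_(w <- ws) `|u w|.
Hypothesis infL : infinite_set [set: Lambda].

Let lamp_act (k : G) (x : lampsT) : G := (k * of_lamps x)%g.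

Definition lamp_values (E : seq Gamma) : seq Gamma :=
  [seq e <- undup E | e != 1%g].

Lemma uniq_lamp_values E : uniq (1%g :: lamp_values E).
Proof. by rewrite /= filter_uniq ?undup_uniq// mem_filter eqxx. Qed.

Lemma mem_lamp_values (E E' : seq Gamma) e : {subset E <= E'} -> e \in E ->
  e \in 1%g :: lamp_values E'.
Proof.
move=> EE' eE; rewrite inE mem_filter mem_undup EE'// andbT.
by case: eqP.
Qed.

(** The supports are pulled back by [lamp_shift k], because multiplying by [k] on the left shifts
    the lamps of the random configuration before [lamps k] is applied. *)
Definition sites_of g : seq Lambda :=
  flatten [seq [seq ((lamp_shift k)^-1 * l)%g |
                l <- enum_fset (finsupp (lamps k))] | k <- g].

Definition values_of g : seq Gamma :=
  flatten [seq [seq lamps k l | l <- enum_fset (finsupp (lamps k))] | k <- g].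

Definition plants_of g (A : seq Lambda) :=
  [seq ([seq lamp_shift k * l | l <- undup A]%g, lamps k) | k <- g].

(** On the translate of [A] the random lamps are off and the product shows [lamps k]; elsewhere
    [lamps k] is trivial and the product shows the shifted [x]. *)
Lemma lamps_act_plant k (A : seq Lambda) x :
  {subset [seq ((lamp_shift k)^-1 * l)%g | l <- enum_fset (finsupp (lamps k))] <= A} ->
  lamps (lamp_act k (plant A one_lamps x)) =
  plant [seq lamp_shift k * l | l <- undup A]%g (lamps k)
        (shift_lamps (lamp_shift k) x).
Proof.
move=> suppA; rewrite lampsM shift_plant; apply/fsfunP => z.
rewrite mul_lampsE !plantE shift_lampsE fsfun0E /=.
have -> : (z \in [seq (lamp_shift k * l)%g | l <- undup A]) =
          (z \in [seq (lamp_shift k * l)%g | l <- A]).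
  by apply/mapP/mapP => -[l lA ->]; exists l; rewrite ?mem_undup// -mem_undup.
case: ifPn => zA; first by rewrite mulg1.
rewrite fsfun_dflt ?mul1g//; apply: contra zA => zs.
apply/mapP; exists ((lamp_shift k)^-1 * z)%g; last by rewrite mulVKg.
by apply: suppA; apply: map_f.
Qed.

Lemma lamps_act_seq_plant g (A : seq Lambda) xs :
  {subset sites_of g <= A} ->
  map (@lamps Gamma Lambda) (act_seq lamp_act g (map (plant A one_lamps) xs)) =
  plants (plants_of g A)
    [seq shift_lamps q.1 q.2 | q <- zip (map (@lamp_shift Gamma Lambda) g) xs].
Proof.
rewrite /act_seq /plants /sites_of; elim: g xs => [|k g IH] [|x xs] //= sA.
rewrite IH; last by move=> l lg; apply: sA; rewrite mem_cat lg orbT.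
congr (_ :: _); apply: lamps_act_plant => l lk.
by apply: sA; rewrite mem_cat lk.
Qed.

Lemma admissible_plants_of g A (E : seq Gamma) : {subset values_of g <= E} ->
  admissible (lamp_values E) (plants_of g A).
Proof.
move=> gE _ /mapP[k kg ->] /=; split.
  by rewrite map_inj_uniq ?undup_uniq//; exact: mulgI.
move=> l _; case: (finsuppP (lamps k) l) => [_|lk]; first by rewrite inE eqxx.
apply: (mem_lamp_values gE); apply/flattenP.
exists [seq lamps k l | l <- enum_fset (finsupp (lamps k))]; first exact: map_f.
exact: map_f.
Qed.

Variable L : mean R (seq Lambda).
Hypothesis L_shift : forall s (f : seq Lambda -> R), bounded_real f ->
  L (fun B => f (map (fun l => s * l)%g B)) = L f.
Hypothesis L_large : forall (A : seq Lambda) (f f' : seq Lambda -> R),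
  bounded_real f -> bounded_real f' ->
  (forall B, {subset A <= B} -> f B = f' B) -> L f = L f'.

(* Switching off the lamps of [q.1] makes left multiplication by an element
   supported there plant its lamps, see [lamps_act_seq_plant]. *)
Definition lamp_family (q : seq Lambda * seq Gamma) : mean R lampsT :=
  mean_push (plant q.1 one_lamps) (lamp_mean L (lamp_values q.2)).

Lemma planted_average_near f M e g (A : seq Lambda) (E : seq Gamma) :
  near_cocycle rho f M e ->
  (forall g', f g' = f [seq of_lamps (lamps k) | k <- g']) ->
  {subset sites_of g <= A} -> {subset values_of g <= E} ->
  `|dual_mean (product_mean (lamp_family (A, E)) (size g))
      (fun xs => f (act_seq lamp_act g xs)) -
    dual_mean (product_mean (lamp_mean L (lamp_values E)) (size g))
      (fun xs => f (map of_lamps xs))| <= 2 * e.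
Proof.
move=> [bf ef _] finv gA gE.
pose phi xs := f (map of_lamps xs).
have bphi xs : `|phi xs| <= M by exact: bf.
have bF (X : Type) (l : X -> seq G) : bounded_family (fun x => f (l x)) by exists M.
have phi_lamps l : f l = phi (map (@lamps Gamma Lambda) l).
  by rewrite /phi -map_comp; exact: finv.
have phi_shift s xs :
    `|rho (of_shift Gamma s) (phi xs) - phi (map (shift_lamps s) xs)| <= e.
  have -> : phi (map (shift_lamps s) xs) =
            f (translate (of_shift Gamma s) (map of_lamps xs)).
    rewrite phi_lamps /translate -!map_comp; congr phi.
    apply: eq_map => x; exact/esym/lamps_shift_mul.
  exact: ef.
have := @planted_mean_near R W Gamma Lambda (fun s => r (of_shift Gamma s))
  (fun s => rho (of_shift Gamma s)) (fun s => rhoE (of_shift Gamma s))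
  (fun s => rho_norm (of_shift Gamma s)) ws K K0 norm_ws infL L L_shift L_large
  (lamp_values E) (uniq_lamp_values E) phi M e bphi phi_shift
  (plants_of g A) (admissible_plants_of (A := A) gE).
rewrite size_map.
suff -> : dual_mean (product_mean (lamp_family (A, E)) (size g))
      (fun xs => f (act_seq lamp_act g xs)) =
    planted_mean L (lamp_values E) phi (plants_of g A) by [].
apply: cdual_ext => w; rewrite /planted_mean size_map.
rewrite (dual_meanE _ _ (bF _ _)) (dual_meanE _ _ (bF _ _)).
rewrite product_mean_push.
rewrite -[in RHS](size_map (@lamp_shift Gamma Lambda) g).
rewrite -[RHS](product_lamp_mean_shift L_shift); last exact: bounded_family_eval.
rewrite size_map; congr (mean_fun (product_mean _ _)); apply/funext => xs.
by rewrite phi_lamps lamps_act_seq_plant.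
Qed.

(** For fixed sites and values the previous estimate covers only some lists [g]. A limit along
    growing pairs of finite sets covers all of them with a single mean. *)
Lemma constant_average f M e : near_cocycle rho f M e ->
  (forall g', f g' = f [seq of_lamps (lamps k) | k <- g']) ->
  exists f' h : seq G -> cdual W,
  [/\ near_cocycle rho f' M e,
      forall n, exists2 C, `|C| <= M &
        forall g, size g = n -> `|f' g - C| <= 2 * e,
      forall g, `|h g| <= (size g)%:R * M,
      forall k g, `|rho k (h g) - h (translate k g)| <= (size g)%:R * e &
      forall g, `|f' g - f g - coboundary h g| <= (size g)%:R * e].
Proof.
move=> nf finv.
pose le (q q' : seq Lambda * seq Gamma) :=
  {subset q.1 <= q'.1} /\ {subset q.2 <= q'.2}.
have [|||T hT] := @directed_mean R _ le _ _ _ ([::], [::]).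
- by move=> q; split.
- move=> q q' q'' [h1 h2] [h3 h4]; split=> x xq.
    exact/h3/h1.
  exact/h4/h2.
- move=> q q'; exists (q.1 ++ q'.1, q.2 ++ q'.2).
    by split=> x xq /=; rewrite mem_cat xq.
  by split=> x xq /=; rewrite mem_cat xq orbT.
pose P n := mean_bind T (fun q => product_mean (lamp_family q) n).
have actM k k' x : lamp_act (k * k')%g x = (k * lamp_act k' x)%g.
  by rewrite /lamp_act mulgA.
have Ps n (h h' : seq lampsT -> R) :
    (forall xs, size xs = n -> h xs = h' xs) -> P n h = P n h'.
  move=> hh'; congr (mean_fun T); apply/funext => q.
  exact: eq_product_mean.
have Pd n j (h : seq lampsT -> R) : bounded_real h -> (j <= n)%N ->
    P n.+1 (fun xs => h (delete j xs)) = P n h.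
  move=> _ jn; congr (mean_fun T); apply/funext => q.
  exact: product_mean_delete.
have [h [h1 h2 h3]] := average_homotopy rhoE rho_norm actM Ps Pd nf.
exists (average lamp_act P f), h; split=> //.
  exact: (average_near rhoE rho_norm actM Ps Pd).
move=> n.
have [bf _ cf] := nf.
have M0 : 0 <= M by exact: le_trans (normr_ge0 _) (bf [::]).
have e0 : 0 <= e by exact: le_trans (normr_ge0 _) (cf [::]).
have bF (X : Type) (l : X -> seq G) : bounded_family (fun x => f (l x)) by exists M.
pose Q (q : seq Lambda * seq Gamma) := product_mean (lamp_mean L (lamp_values q.2)) n.
(* The same lamps, not switched off and without multiplication by [g]: the result depends on [n]
   only. *)
exists (dual_mean (mean_bind T Q) (fun xs => f (map of_lamps xs))).
  by apply: dual_mean_norm.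
move=> g gn; rewrite /average /average2 gn.
apply: cdual_norm_bound => [|w]; first by rewrite mulr_ge0.
rewrite cdualBE (dual_meanE _ _ (bF _ (fun x => act_seq lamp_act g x))).
rewrite (dual_meanE _ _ (bF _ (map of_lamps))).
have bb1 : bounded_real (fun q => product_mean (lamp_family q) n
    (fun xs => f (act_seq lamp_act g xs) w)).
  by apply: bind_bounded; exact: bounded_family_eval.
have bb2 : bounded_real (fun q => Q q (fun xs => f (map of_lamps xs) w)).
  by apply: bind_bounded; exact: bounded_family_eval.
rewrite -[X in `|X|](meanB T bb1 bb2).
have near q : le (sites_of g, values_of g) q ->
    `|product_mean (lamp_family q) n (fun xs => f (act_seq lamp_act g xs) w) -
      Q q (fun xs => f (map of_lamps xs) w)| <= 2 * e * `|w|.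
  case: q => A E [/= gA gE].
  have := planted_average_near nf finv gA gE; rewrite gn => near.
  rewrite -(dual_meanE _ _ (bF _ (fun x => act_seq lamp_act g x))).
  rewrite -(dual_meanE _ _ (bF _ (map of_lamps))) -cdualBE.
  by rewrite (le_trans (cdual_op_norm _ _))// ler_wpM2r.
have bd := bounded_realD bb1 (bounded_realN bb2).
rewrite ler_norml; apply/andP; split.
  rewrite lerNl -meanN//; apply: (hT (sites_of g, values_of g)).
    exact: bounded_realN.
  by move=> q /near; rewrite -[X in X <= _]normrN; apply: le_trans; exact: ler_norm.
apply: (hT (sites_of g, values_of g)) => // q /near.
by apply: le_trans; exact: ler_norm.
Qed.

End ConstantAverage.

(** * Approximate primitives with constants depending on the degree only *)

Section NearPrimitive.
Variables (R : realType) (W : normedModType R) (Gamma Lambda : groupType).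
Local Notation G := (lamplighter Gamma Lambda).
Variables (r : G -> W -> W) (rho : G -> cdual W -> cdual W).
Hypothesis rhoE : forall k u w, rho k u w = u (r k w).
Hypothesis rho_norm : forall k u, `|rho k u| = `|u|.
Variables (ws : seq W) (K : R).
Hypothesis K0 : 0 <= K.
Hypothesis norm_ws : forall u : cdual W, `|u| <= K * \sum_(w <- ws) `|u w|.
Hypothesis infL : infinite_set [set: Lambda].
Hypothesis amenL : amenable R Lambda.
Implicit Types (f : seq G -> cdual W) (g : seq G) (k : G).

(** Go from [rho k C] to [C] through [rho k (f g)] and [f (translate k g)], at cost 2e + e + 2e. *)
Lemma near_constant_invariant f (C : cdual W) M e n : near_cocycle rho f M e ->
  (forall g, size g = n -> `|f g - C| <= 2 * e) ->
  forall k, `|rho k C - C| <= 5 * e.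
Proof.
move=> [_ ef _] fC k; pose g := nseq n (1%g : G).
have sg : size g = n by rewrite size_nseq.
have sk : size (translate k g) = n by rewrite size_translate.
have h1 : `|rho k (f g) - rho k C| <= 2 * e.
  by rewrite -(rhoB rhoE) rho_norm; exact: fC.
have h2 := ef k g; have h3 := fC _ sk.
rewrite distrC in h1.
have h4 := ler_distD (rho k (f g)) (rho k C) C.
have h5 := ler_distD (f (translate k g)) (rho k (f g)) C.
by lra.
Qed.

(** On a list of odd length [n.+1] the coboundary of the constant [C] is [C]. That of [f] is at most
    [e], and the [n.+1] faces differ by at most [2 * e] each. *)
Lemma near_constant_vanish f (C : cdual W) M e n : near_cocycle rho f M e ->
  ~~ odd n -> (forall g, size g = n -> `|f g - C| <= 2 * e) ->
  `|C| <= (2 * n%:R + 3) * e.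
Proof.
move=> [_ _ cf] on fC; pose g := nseq n.+1 (1%g : G).
have sg : size g = n.+1 by rewrite size_nseq.
have -> : C = coboundary f g - coboundary (fun s => f s - C) g.
  by rewrite coboundaryB coboundary_cst sg /= on subKr.
rewrite (le_trans (ler_normB _ _))//.
have h : `|coboundary (fun s => f s - C) g| <= n.+1%:R * (2 * e).
  rewrite (le_trans (ler_norm_sum _ _ _))//.
  rewrite (@le_trans _ _ (\sum_(j < size g) (2 * e)))//.
    apply: ler_sum => j _; rewrite normrZ normrX normrN1 expr1n mul1r.
    by apply: fC; rewrite size_delete ?ltn_ord // sg.
  by rewrite sumr_const card_ord sg -[(2 * e) *+ _]mulr_natl.
by have := cf g; move: h; rewrite -natr1; lra.
Qed.

Lemma near_primitive f M e n : near_cocycle rho f M e ->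
  exists h : seq G -> cdual W,
  [/\ forall g, `|h g| <= (2 * (size g)%:R + 1) * M,
      forall k g, `|rho k (h g) - h (translate k g)| <=
        (2 * (size g)%:R + 5) * e &
      forall g, size g = n -> `|f g - coboundary h g| <= (4 * n%:R + 5) * e].
Proof.
move=> nf; have [L [L_shift L_large]] := amenable_set_mean amenL.
have [f1 [h1 [nf1 f1inv bh1 ih1 ph1]]] := right_invariant_cochain rhoE rho_norm amenL nf.
have [f2 [h2 [nf2 f2C bh2 ih2 ph2]]] :=
  constant_average rhoE rho_norm K0 norm_ws infL L_shift L_large nf1 f1inv.
have [C CM f2Cn] := f2C n.
have M0 : 0 <= M by exact: le_trans (normr_ge0 _) CM.
have e0 : 0 <= e by have [_ _ c] := nf; exact: le_trans (normr_ge0 _) (c [::]).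
(* [n] counts arguments, so odd [n] is even degree, where [C] is the coboundary of the constant [C].
   For even [n] coboundaries of constants vanish, and [C] itself is small. *)
pose c : cdual W := if odd n then C else 0.
have cM : `|c| <= M by rewrite /c; case: odd; rewrite ?normr0.
have ci k : `|rho k c - c| <= 5 * e.
  rewrite /c; case: odd; first exact: (near_constant_invariant nf2 f2Cn).
  by rewrite (rho0 rhoE) subrr normr0 mulr_ge0.
exists (fun g => c - (h1 g + h2 g)); split=> [g|k g|g gn].
- rewrite (le_trans (ler_normB _ _))//.
  have := ler_normD (h1 g) (h2 g); have := bh1 g; have := bh2 g; move: cM; lra.
- have -> : rho k (c - (h1 g + h2 g)) -
      (c - (h1 (translate k g) + h2 (translate k g))) =
    (rho k c - c) - ((rho k (h1 g) - h1 (translate k g)) +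
                     (rho k (h2 g) - h2 (translate k g))).
    apply: cdual_ext => w; rewrite !(cdualNE, cdualDE, rhoE) /=.
    by ring.
  rewrite (le_trans (ler_normB _ _))//.
  have := ler_normD (rho k (h1 g) - h1 (translate k g))
    (rho k (h2 g) - h2 (translate k g)).
  by have := ih1 k g; have := ih2 k g; have := ci k; lra.
- rewrite coboundaryB coboundaryD coboundary_cst gn.
  have Cc : `|C - (if odd n then c else 0)| <= (2 * n%:R + 3) * e.
    rewrite /c; case: (boolP (odd n)) => on.
      by rewrite subrr normr0 mulr_ge0// addr_ge0// mulr_ge0.
    by rewrite subr0; exact: (near_constant_vanish nf2 on f2Cn).
  have := ph1 g; have := ph2 g; have := f2Cn g gn; move: Cc; rewrite gn.
  set x := if _ then _ else _; set a := coboundary h1 g; set b := coboundary h2 g.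
  move=> Cx fC p2 p1.
  (* The four errors are 2e, (2n + 3)e, ne and ne. *)
  have -> : f g - (x - (a + b)) =
    (f2 g - C) + (C - x) - (f2 g - f1 g - b) - (f1 g - f g - a).
    apply: cdual_ext => w; rewrite !(cdualNE, cdualDE); ring.
  have := ler_normB (f2 g - C + (C - x) - (f2 g - f1 g - b)) (f1 g - f g - a).
  have := ler_normB (f2 g - C + (C - x)) (f2 g - f1 g - b).
  have := ler_normD (f2 g - C) (C - x).
  lra.
Qed.

End NearPrimitive.

(** * Transfer to the ultraproduct *)

Section IndexPrimitive.
Variables (w : nonprincipal_ultrafilter) (R : realType) (Gamma Lambda : groupType).
Local Notation G := (lamplighter Gamma Lambda).
Hypothesis infL : infinite_set [set: Lambda].
Hypothesis amenL : amenable R Lambda.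
Variables (V W : asymptotic_module w R G) (i : nat).
Variable phi : V i -> cdual (W i).
Hypothesis lphi : linear phi.
Hypothesis phi_norm : forall v, `|phi v| = `|v|.
Hypothesis bphi : bijective phi.
Hypothesis phi_act : forall g v,
  phi (@aact _ _ _ V i g v) = contragredient g (phi v).
Variable k : nat.
Hypothesis finV : Vector.axiom k (V i).

Lemma phiB u v : phi (u - v) = phi u - phi v.
Proof. by rewrite -[u - v]addrC -scaleN1r lphi scaleN1r addrC. Qed.

Lemma phi0 : phi 0 = 0.
Proof. by have := phiB 0 0; rewrite !subrr. Qed.

Lemma phi_sum (I : Type) (s : seq I) (a : I -> R) (F : I -> V i) :
  phi (\sum_(j <- s) a j *: F j) = \sum_(j <- s) a j *: phi (F j).
Proof.
elim: s => [|j s IH]; first by rewrite !big_nil phi0.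
by rewrite !big_cons lphi IH.
Qed.

(** Transposing a norm-preserving map directly gives only an inequality; equality is transported
    from [V] by the onto isometry [phi]. *)
Lemma contragredient_norm g (u : cdual (W i)) : `|contragredient g u| = `|u|.
Proof.
by have [psi _ psiK] := bphi; rewrite -(psiK u) -phi_act !phi_norm aact_norm.
Qed.

Section Cochains.
Variables (d : nat) (f : cochain V d i).

Definition list_cochain (s : seq G) : cdual (W i) :=
  if size s == d then phi (f (fun j : 'I_d => nth 1%g s j)) else 0.

Lemma list_cochain_near e :
  (forall g, `|cochain_act g f - f| <= e) -> `|cochain_d f| <= e ->
  near_cocycle (@contragredient w R G W i) list_cochain `|f| e.
Proof.
move=> fe fd; have e0 : 0 <= e by exact: le_trans (normr_ge0 _) fd.
split=> [s|g s|s].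
- rewrite /list_cochain; case: eqP => _; last by rewrite normr0.
  by rewrite phi_norm; exact: linf_normP.
- rewrite /list_cochain size_translate; case: eqP => [sd|_]; last first.
    have -> : contragredient g 0 = 0 :> cdual (W i) by exact: cdual_ext.
    by rewrite subrr normr0.
  rewrite -phi_act -phiB phi_norm.
  set x : 'I_d -> G := fun j => nth 1%g s j.
  have -> : (fun j : 'I_d => nth 1%g (translate g s) j) = (fun j => g * x j)%g.
    by apply/funext => j; rewrite (nth_map 1%g)// sd.
  have -> : aact g (f x) - f (fun j => g * x j)%g =
      (cochain_act g f - f) (fun j => g * x j)%g.
    rewrite -[RHS]/(aact g (f _) - f _); congr (aact g (f _) - _).
    by apply/funext => j; rewrite mulKg.
  exact: le_trans (linf_normP _ _) (fe g).
- have [sd|sd] := eqVneq (size s) d.+1; last first.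
    (* No face of [s] has length [d], so every term is the default 0. *)
    rewrite /coboundary big1 ?normr0// => j _.
    rewrite /list_cochain size_delete// ifN ?scaler0//.
    by rewrite -eqSS prednK//; case: s j {sd} (sd) => // -[].
  rewrite (@le_trans _ _ `|phi (cochain_d f (fun j => nth 1%g s j))|)//; last first.
    by rewrite phi_norm; exact: le_trans (linf_normP _ _) fd.
  rewrite -[cochain_d f _]/(\sum_(j < d.+1) _) phi_sum /coboundary sd.
  rewrite le_eqVlt; apply/orP; left; apply/eqP; congr `|_|.
  apply: eq_bigr => j _; rewrite /list_cochain size_delete sd// eqxx.
  congr (_ *: phi (f _)); apply/funext => l.
  by rewrite nth_delete// sd.
Qed.

Lemma list_cochainE (x : 'I_d -> G) :
  list_cochain [seq x j | j <- enum 'I_d] = phi (f x).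
Proof.
rewrite /list_cochain size_map size_enum_ord eqxx; congr (phi (f _)).
apply/funext => j; rewrite (nth_map j) ?size_enum_ord//.
by rewrite nth_ord_enum.
Qed.

End Cochains.

Lemma delete_map_enum d (x : 'I_d.+1 -> G) (j : 'I_d.+1) :
  delete j [seq x l | l <- enum 'I_d.+1] =
  [seq x (lift j l) | l <- enum 'I_d].
Proof.
have sx : size [seq x l | l <- enum 'I_d.+1] = d.+1.
  by rewrite size_map size_enum_ord.
apply: (@eq_from_nth _ 1%g).
  by rewrite size_delete ?sx// size_map size_enum_ord.
move=> l; rewrite size_delete ?sx//= => ld.
pose l' := Ordinal ld.
rewrite nth_delete ?sx// -[l]/(nat_of_ord l') (nth_map l') ?size_enum_ord//.
rewrite nth_ord_enum (nth_map j) ?size_enum_ord; last exact: (ltn_ord (lift j l')).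
by congr x; apply: val_inj; rewrite /= nth_enum_ord//; exact: (ltn_ord (lift j l')).
Qed.

(** The constant is 4(m + 2) + 5, from [near_primitive] at length [m.+2]; it also dominates 2(m + 1)
    + 1 and 2(m + 1) + 5. *)
Lemma index_primitive m (f : cochain V m.+2 i) e :
  (forall g, `|cochain_act g f - f| <= e) -> `|cochain_d f| <= e ->
  exists h : cochain V m.+1 i,
  [/\ `|h| <= (4 * m%:R + 13) * `|f|,
      forall g, `|cochain_act g h - h| <= (4 * m%:R + 13) * e &
      `|cochain_d h - f| <= (4 * m%:R + 13) * e].
Proof.
move=> fe fd; have e0 : 0 <= e by exact: le_trans (normr_ge0 _) fd.
have [ws [K [K0 hws]]] := norming_vectors lphi bphi finV.
have [h [hb he hd]] := @near_primitive R (W i) Gamma Lambda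
  (fun g => @aact _ _ _ W i g^-1%g) (@contragredient w R G W i)
  (fun _ _ _ => erefl) contragredient_norm ws K K0 hws infL amenL
  _ _ _ m.+2 (list_cochain_near fe fd).
have [psi phiK psiK] := bphi.
have psi_norm u : `|psi u| = `|u| by rewrite -phi_norm psiK.
pose s (x : 'I_m.+1 -> G) := [seq x j | j <- enum 'I_m.+1].
have ss x : size (s x) = m.+1 by rewrite size_map size_enum_ord.
have cM : 0 <= 4 * m%:R + 13 :> R by rewrite addr_ge0// mulr_ge0.
have m0 : 0 <= m%:R :> R by [].
have hc_bd (x : 'I_m.+1 -> G) : `|psi (h (s x))| <= (4 * m%:R + 13) * `|f|.
  rewrite psi_norm (le_trans (hb _))// ss ler_wpM2r//.
  by rewrite -natr1; lra.
have hc_in : (fun x => psi (h (s x))) \in @linf_pred R ('I_m.+1 -> G) (V i).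
  by apply/linf_predP; exists ((4 * m%:R + 13) * `|f|).
exists (Linf hc_in); split=> [|g|].
- by apply: linf_norm_le => //; rewrite mulr_ge0.
- apply: linf_norm_le => [|x]; first by rewrite mulr_ge0.
  rewrite -[X in `|X|]/(aact g (psi (h (s (fun j => g^-1 * x j)%g))) - psi (h (s x))).
  rewrite -phi_norm phiB phi_act !psiK.
  have -> : s x = translate g (s (fun j => g^-1 * x j)%g).
    rewrite /s /translate -[RHS]map_comp; apply: eq_map => j; by rewrite /= mulVKg.
  rewrite (le_trans (he _ _))// ss ler_wpM2r//.
  by rewrite -natr1; lra.
- apply: linf_norm_le => [|x]; first by rewrite mulr_ge0.
  rewrite -[X in `|X|]/(\sum_(j < m.+2)
    (-1) ^+ j *: psi (h (s (fun l => x (lift j l)))) - f x).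
  rewrite -phi_norm phiB phi_sum -list_cochainE distrC.
  have sx : size [seq x j | j <- enum 'I_m.+2] = m.+2.
    by rewrite size_map size_enum_ord.
  have -> : \sum_(j < m.+2) (-1) ^+ j *: phi (psi (h (s (fun l => x (lift j l))))) =
     coboundary h [seq x j | j <- enum 'I_m.+2].
    rewrite /coboundary sx; apply: eq_bigr => j _.
    by rewrite psiK delete_map_enum.
  rewrite (le_trans (hd _ sx))// ler_wpM2r//.
  by rewrite -!natr1; lra.
Qed.

End IndexPrimitive.

Lemma forall_exists_choice (T : Type) (U : T -> Type) (Q : forall x, U x -> Prop) :
  (forall x, exists y, Q x y) -> exists f : forall x, U x, forall x, Q x (f x).
Proof. by move=> h; exists (fun x => sval (cid (h x))) => x; exact: svalP. Qed.

(** * Asymptotic cochains read index by index *)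

Section UltraproductTransfer.
Variables (w : nonprincipal_ultrafilter) (R : realType).

(** Apply the hypothesis to a sequence picking a counterexample at each index that has one, and [t0]
    elsewhere. *)
Lemma ultra_forall (T : nat -> Type) (t0 : forall i, T i)
    (Q : forall i, T i -> Prop) :
  (forall t : forall i, T i, w [set i | Q i (t i)]) ->
  w [set i | forall t, Q i t].
Proof.
move=> h.
have pick i : exists t : T i, Q i t -> forall t', Q i t'.
  have [all|/existsNP[t nt]] := pselect (forall t', Q i t').
    by exists (t0 i).
  by exists t.
have [t ht] := forall_exists_choice pick.
by apply: filterS (h t) => i /ht.
Qed.

Variables (G : groupType) (V : asymptotic_module w R G).

Lemma uact_uclass d (a : nat -> G) (F : forall i, cochain V d i) :
  uact (@cochain_act w R G V d) (uclass w a) (uclass w F) =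
  uclass w (fun i => cochain_act (a i) (F i)).
Proof. exact: umap2E. Qed.

(** An element of [star_group] may be the worst one at every index, so invariance modulo
    infinitesimals is uniform over the group. *)
Lemma invariantsP d (F : forall i, cochain V d i) :
  (uclass w F : uspace w (cochain V d)) \in @uspace_bounded w R (cochain V d) ->
  tclass (uclass w F : uspace w (cochain V d)) \in @invariants w R G V d <->
  forall e : R, 0 < e -> w [set i | forall g, `|cochain_act g (F i) - F i| <= e].
Proof.
move=> bF.
have bactF a : (uact (@cochain_act w R G V d) (uclass w a) (uclass w F)
    : uspace w (cochain V d)) \in @uspace_bounded w R (cochain V d).
  exact: (umap_bounded (tilde_act_bounded V d (uclass w a)) bF).
have actE (a : nat -> G) :
    tilde_act (V := V) (uclass w a : star_group w G) (tclass (uclass w F)) =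
    tclass (uact (@cochain_act w R G V d) (uclass w a) (uclass w F)).
  exact: (tmapE (tilde_act_bounded V d (uclass w a)) bF).
split=> [/asboolP inv e e0|h].
  apply: (@ultra_forall (fun=> G) (fun=> 1%g)
    (fun i g => `|cochain_act g (F i) - F i| <= e)) => a.
  have := inv (uclass w a); rewrite actE => /(tclass_eqP (bactF a) bF).
  rewrite uact_uclass uspace_subE => /uspace_infinitesimalP; exact.
apply/asboolP => g; rewrite -[g](uclass_repr (X := fun=> G)) actE.
apply/(tclass_eqP (bactF _) bF); rewrite uact_uclass uspace_subE.
apply/uspace_infinitesimalP => e e0.
by apply: filterS (h e e0) => i /=; exact.
Qed.

Lemma tilde_d_eqP d (F : forall i, cochain V d i) (F' : forall i, cochain V d.+1 i) :
  (uclass w F : uspace w (cochain V d)) \in @uspace_bounded w R (cochain V d) ->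
  (uclass w F' : uspace w (cochain V d.+1)) \in @uspace_bounded w R (cochain V d.+1) ->
  tilde_d (tclass (uclass w F : uspace w (cochain V d))) =
    tclass (uclass w F' : uspace w (cochain V d.+1)) <->
  forall e : R, 0 < e -> w [set i | `|cochain_d (F i) - F' i| <= e].
Proof.
move=> bF bF'; rewrite /tilde_d (tmapE (cochain_d_bounded V d) bF).
rewrite tclass_eqP//; last exact: (umap_bounded (cochain_d_bounded V d)).
by rewrite /uspace_map umapE uspace_subE uspace_infinitesimalP.
Qed.

End UltraproductTransfer.

Theorem theorem1p7 (R : realType) (w : nonprincipal_ultrafilter)
    (Gamma Lambda : groupType) :
  countable [set: Gamma] -> countable [set: Lambda] ->
  infinite_set [set: Lambda] -> amenable R Lambda ->
  forall V : asymptotic_module w R (lamplighter Gamma Lambda),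
  finitary V -> is_dual V ->
  forall n : nat, (1 <= n)%N ->
  forall c : asymptotic_cohomology V n, c = 0.
Proof.
move=> _ _ infL amenL V finV [W [phi [lphi nphi bphi aphi]]] [//|m] _ c.
pose G := lamplighter Gamma Lambda.
(* Duality is an identity in the ultraproduct; at a single index [phi] need only intertwine the maps
   on a set of the ultrafilter. *)
have good : w [set i | forall q : G * V i,
    phi i (@aact _ _ _ V i q.1 q.2) = contragredient q.1 (phi i q.2)].
  apply: (@ultra_forall w (fun i => (G * V i)%type) (fun i => (1%g, 0))
    (fun i q => phi i (@aact _ _ _ V i q.1 q.2) = contragredient q.1 (phi i q.2))).
  move=> q; have := aphi (uclass w (fun i => (q i).1)) (uclass w (fun i => (q i).2)).
  by rewrite /uspace_map /uact umap2E !umapE umap2E => /uclassP.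
suff h (x : tilde w (cochain V m.+2)) :
    x \in @cocycles w R G V m.+1 -> x \in @coboundaries w R G V m.+1.
  have : repr c - 0 \in @cocycle_coboundaries w R G V m.+1.
    rewrite subr0; apply: h; exact: cocycleP.
  rewrite Quotient.idealrBE => /eqP; rewrite reprK => ->.
  exact: raddf0.
rewrite -(tclass_repr x); set u := trepr x.
have bu : u \in @uspace_bounded w R (cochain V m.+2) := trepr_bounded x.
move: u bu => u; rewrite -(uclass_repr u); move: (urepr u) => F bF.
move=> /andP[/(invariantsP bF) invF /eqP dF].
have clF (e : R) : 0 < e -> w [set i | `|cochain_d (F i)| <= e].
  move=> e0.
  have b0 : (uclass w (fun i => (0 : cochain V m.+3 i)) : uspace w (cochain V m.+3))
      \in @uspace_bounded w R (cochain V m.+3).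
    by apply/uspace_boundedP; exists 0; apply: filterE => i /=; rewrite normr0.
  rewrite -(tclass0 w (cochain V m.+3)) in dF.
  have := (tilde_d_eqP bF b0).1 dF e e0.
  by apply: filterS => i /=; rewrite subr0.
(* With the exact defect at each index in place of a fixed error, one sequence of primitives serves
   for all errors at once. *)
pose defect i : R := Num.max (sup (range (fun g : G => `|cochain_act g (F i) - F i|)))
  `|cochain_d (F i)|.
have defect_act i (g : G) : `|cochain_act g (F i) - F i| <= defect i.
  rewrite le_max; apply/orP; left; apply: ub_le_sup; last by exists g.
  exists (`|F i| + `|F i|) => _ [g' _ <-].
  by rewrite (le_trans (ler_normB _ _))// lerD// cochain_act_norm_le.
have defect_le i e : (forall g : G, `|cochain_act g (F i) - F i| <= e) ->
    `|cochain_d (F i)| <= e -> defect i <= e.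
  move=> h1 h2; rewrite ge_max h2 andbT; apply: ge_sup.
    by exists `|cochain_act (1%g : G) (F i) - F i|, 1%g.
  by move=> _ [g _ <-].
pose K : R := 4 * m%:R + 13.
have K0 : 0 < K by rewrite ltr_wpDl// mulr_ge0.
have hex i : exists h : cochain V m.+1 i, (forall q : G * V i,
    phi i (@aact _ _ _ V i q.1 q.2) = contragredient q.1 (phi i q.2)) ->
  [/\ `|h| <= K * `|F i|,
      forall g : G, `|cochain_act g h - h| <= K * defect i &
      `|cochain_d h - F i| <= K * defect i].
  have [gi|ngi] := pselect (forall q : G * V i,
    phi i (@aact _ _ _ V i q.1 q.2) = contragredient q.1 (phi i q.2)); last first.
    (* A default value, at indices outside [good]. *)
    by exists 0 => /ngi.
  have [k [fin]] := finV i.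
  have [|h hP] := index_primitive infL amenL (lphi i) (nphi i) (bphi i)
    (fun g v => gi (g, v)) fin (defect_act i).
    by rewrite le_max lexx orbT.
  by exists h.
have [h hP] := forall_exists_choice hex.
have bh : (uclass w h : uspace w (cochain V m.+1))
    \in @uspace_bounded w R (cochain V m.+1).
  have /uspace_boundedP[M FM] := bF; apply/uspace_boundedP; exists (K * M).
  apply: filterS2 good FM => i /hP[h1 _ _] FM.
  by rewrite /= (le_trans h1)// ler_wpM2l// ltW.
have small (e : R) : 0 < e -> w [set i | K * defect i <= e].
  move=> e0; have eK : 0 < e / K by rewrite divr_gt0.
  apply: filterS2 (invF _ eK) (clF _ eK) => i h1 h2.
  by rewrite /= mulrC -ler_pdivlMr//; exact: defect_le.
apply/asboolP; exists (tclass (uclass w h)).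
  apply/(invariantsP bh) => e e0.
  apply: filterS2 good (small e e0) => i /hP[_ h2 _] /= h3 g.
  exact: le_trans (h2 g) h3.
apply/(tilde_d_eqP bh bF) => e e0.
apply: filterS2 good (small e e0) => i /hP[_ _ h2] /=.
exact: le_trans h2.
Qed.
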